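(* Let $p_1,p_2,r\ge1$, $\sigma>0$, and $\Sigma\in\mathbb{R}^{p_1p_2\times p_1p_2}$ a covariance matrix. Let $\mathcal{A}_r=\{B\in\mathbb{R}^{p_1\times p_2}\setminus\{0\}:\mathrm{rank}(B)\le r\}$. For $B\in\mathcal{A}_r$ let $P_B$ be the law of $(X,y)\in\mathbb{R}^{p_1\times p_2}\times\mathbb{R}$ with $\mathrm{vec}(X)\sim N(0,\Sigma)$ and $y\mid X\sim N(\mathrm{Tr}(X^TB),\sigma^2)$. For $\epsilon\in[0,1)$ and an arbitrary $Q$, let $(X_1,y_1),\dots,(X_n,y_n)$ be i.i.d. from $\mathbb{P}_{(\epsilon,B,Q)}=(1-\epsilon)P_B+\epsilon Q$. For $\mathcal{U}\subset\mathbb{R}^{p_1\times p_2}$ and a distribution $\mathbb{P}$ of $(X,y)$ define $\mathcal{D}_{\mathcal{U}}(B,\mathbb{P})=\inf_{U\in\mathcal{U}}\mathbb{P}\{\langle U,X\rangle(y-\langle B,X\rangle)\ge0\}$, with $\langle A,B\rangle=\mathrm{Tr}(AB^T)$, and let $\widehat B$ be any maximizer over $B\in\mathcal{A}_r$ of $\mathcal{D}_{\mathcal{A}_{2r}}(B,\mathbb{P}_n)$, $\mathbb{P}_n$ the empirical measure. Let $\kappa=\inf_{\mathrm{rank}(A)=2r}\|\Sigma^{1/2}\mathrm{vec}(A)\|/\|A\|_{\rm F}$. Then there exist absolute constants $c_0,C,C'>0$ such that whenever $\epsilon^2+\frac{r(p_1+p_2)}{n}\le c_0$, $$\|\Sigma^{1/2}\mathrm{vec}(\widehat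 B-B)\|^2\le C\sigma^2\Big(\frac{r(p_1+p_2)}{n}\vee\epsilon^2\Big),\quad \|\widehat B-B\|_{\rm F}^2\le C\frac{\sigma^2}{\kappa^2}\Big(\frac{r(p_1+p_2)}{n}\vee\epsilon^2\Big),$$ $$\|\widehat B-B\|_{\rm N}^2\le C\frac{\sigma^2}{\kappa^2}\Big(\frac{r^2(p_1+p_2)}{n}\vee r\epsilon^2\Big),$$ with $\mathbb{P}_{(\epsilon,B,Q)}$-probability at least $1-\exp\big(-C'(r(p_1+p_2)+n\epsilon^2)\big)$, uniformly over all $Q$ and $B\in\mathcal{A}_r$.
   Context: $\mathrm{vec}(A)$ is the vectorization, $\|A\|_{\rm F}$ the Frobenius norm, $\|A\|_{\rm N}$ the nuclear norm (sum of singular values). $a\vee b=\max(a,b)$.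
   Formalization: κ is the infimum over nonzero A with rank(A) ≤ 2r instead of rank(A) = 2r: no matrix has rank 2r when 2r > min(p1,p2), so κ would be undefined there; when 2r ≤ min(p1,p2) the two infima agree by density and continuity. *)

(* Defs.v *)
From HB Require Import structures.
From mathcomp Require Import all_boot all_order all_algebra.
From mathcomp Require Import all_classical all_reals all_analysis.
Set Implicit Arguments. Unset Strict Implicit. Unset Printing Implicit Defensive.
Import Order.TTheory GRing.Theory Num.Theory.
Local Open Scope classical_set_scope.
Local Open Scope ring_scope.

Section defs.
Context {R : realType}.

Definition minner (p1 p2 : nat) (A B : 'M[R]_(p1, p2)) : R := \tr (A *m B^T).

Definition frob (p1 p2 : nat) (A : 'M[R]_(p1, p2)) : R :=
  Num.sqrt (\sum_(i < p1) \sum_(j < p2) A i j ^+ 2).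

Definition enorm (m : nat) (v : 'cV[R]_m) : R :=
  Num.sqrt (\sum_(k < m) v k 0 ^+ 2).

Definition vecc (p1 p2 : nat) (A : 'M[R]_(p1, p2)) : 'cV[R]_(p1 * p2) :=
  (mxvec A)^T.

Definition lowrank (p1 p2 k : nat) (A : 'M[R]_(p1, p2)) : Prop :=
  A != 0 /\ (\rank A <= k)%N.

Definition psd (m : nat) (S : 'M[R]_m) : Prop :=
  S^T = S /\ forall v : 'cV[R]_m, 0 <= (v^T *m S *m v) 0 0.

Definition is_svd (p1 p2 : nat) (A : 'M[R]_(p1, p2))
    (U : 'M[R]_p1) (D : 'M[R]_(p1, p2)) (V : 'M[R]_p2) : Prop :=
  [/\ U^T *m U = 1%:M, V^T *m V = 1%:M,
      (forall (i : 'I_p1) (j : 'I_p2), (i : nat) != j -> D i j = 0),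
      (forall (i : 'I_p1) (j : 'I_p2), 0 <= D i j)
    & A = U *m D *m V^T].

(* sum of the singular values read off an SVD (= nuclear norm) *)
Definition svd_sum (p1 p2 : nat) (D : 'M[R]_(p1, p2)) : R :=
  \sum_(i < p1) \sum_(j < p2) D i j.

(* kappa = inf over nonzero A with rank <= 2r of |S vec A| / |A|_F,
   S = Sigma^{1/2} *)
Definition kappa (p1 p2 r : nat) (S : 'M[R]_(p1 * p2)) : R :=
  inf [set k | exists A : 'M[R]_(p1, p2),
          lowrank (2 * r) A /\ k = enorm (S *m vecc A) / frob A].

(* observations (vec X, y); vec X is stored as a (p1*p2)-tuple *)
Definition Obs (p1 p2 : nat) := ((p1 * p2).-tuple R * R)%type.

Definition mat_of (p1 p2 : nat) (x : (p1 * p2).-tuple R) : 'M[R]_(p1, p2) :=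
  vec_mx (\row_k tnth x k).

Definition col_of (m : nat) (x : m.-tuple R) : 'cV[R]_m := \col_k tnth x k.

Definition normal_law (m v : R) : set R -> \bar R :=
  if v == 0 then \d_m else normal_prob m (Num.sqrt v).

Definition is_gaussian (m : nat) (gamma : probability (m.-tuple R) R)
    (Sigma : 'M[R]_m) : Prop :=
  forall (u : 'cV[R]_m) (C : set R), measurable C ->
    gamma [set x | C ((u^T *m col_of x) 0 0)] =
    normal_law 0 ((u^T *m Sigma *m u) 0 0) C.

(* PB is the law of (vec X, y) with vec X ~ gamma and
   y | X ~ N(<X,B>, sigma^2) *)
Definition is_model (p1 p2 : nat) (PB : probability (Obs p1 p2) R)
    (gamma : probability ((p1 * p2).-tuple R) R) (B : 'M[R]_(p1, p2))
    (sigma : R) : Prop :=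
  forall (A : set ((p1 * p2).-tuple R)) (C : set R),
    measurable A -> measurable C ->
    PB (A `*` C) =
    (\int[gamma]_(x in A) normal_prob (minner (mat_of x) B) sigma C)%E.

Definition iid_mixture (p1 p2 n : nat) (Prob : probability (n.-tuple (Obs p1 p2)) R)
    (PB Q : probability (Obs p1 p2) R) (eps : R) : Prop :=
  (forall (i : 'I_n) (A : set (Obs p1 p2)), measurable A ->
     Prob [set s | A (tnth s i)] = ((1 - eps)%:E * PB A + eps%:E * Q A)%E)
  /\
  (forall A : 'I_n -> set (Obs p1 p2), (forall i, measurable (A i)) ->
     Prob [set s | forall i, A i (tnth s i)] =
     (\prod_(i < n) Prob [set s | A i (tnth s i)])%E).

Definition emp_depth (p1 p2 n r : nat) (s : n.-tuple (Obs p1 p2))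
    (B : 'M[R]_(p1, p2)) : R :=
  inf [set d | exists U : 'M[R]_(p1, p2), lowrank (2 * r) U /\
     d = (#|[set i : 'I_n | 0 <= minner U (mat_of (tnth s i).1) *
              ((tnth s i).2 - minner B (mat_of (tnth s i).1))]|)%:R / n%:R].

Definition is_depth_max (p1 p2 n r : nat) (s : n.-tuple (Obs p1 p2))
    (Bh : 'M[R]_(p1, p2)) : Prop :=
  lowrank r Bh /\
  forall B' : 'M[R]_(p1, p2), lowrank r B' ->
    emp_depth r s B' <= emp_depth r s Bh.

End defs.

(* Main.v *)
(* Along U, an observation contributes to the depth of B' through the sign of
   <U,X> (y - <B',X>).  Scaling B' - B down to |Sigma^{1/2} vec(B' - B)| = b, it suffices to
   control, uniformly over U of rank at most 2r with |Sigma^{1/2} vec U| = 1, the empirical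
   frequencies of the sets {<U,X> (z - b <U,X>) >= 0}, z = y - <B,X>, for b = 0 (depth of B) and
   for b of order sigma tau (depth of an estimator which is too far), where
   tau^2 = r(p1+p2)/n + eps^2.  The population frequencies under P_B are at least 1/2 and at most
   1/2 - c b / sigma, so deviations of order tau are what is needed.

   Such deviations, without logarithmic factor, come from chaining.  The covering numbers
   (C/s)^{C r(p1+p2)}, valid for every Sigma, follow from linear algebra: a high power of the Gram
   matrix of a separated family has rank at most the number of monomials of the corresponding
   degree in the entries of the factors of U, and it is diagonally dominant, hence invertible.
   Two sets with close directions U, V differ only where <V,X> or z - b <V,X> is small or
   <U - V,X> is large, so Bernstein's inequality with geometrically decreasing variances sums to
   order tau.  Below the scale tau, the increments are large only on few observations of a region
   where the mixture is dominated by 2 P_B (Hahn decomposition); the contaminated remainder has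
   mass of order eps. *)
Require Import Defs.
From HB Require Import structures.
From mathcomp Require Import all_boot all_order all_algebra.
From mathcomp Require Import all_classical all_reals all_analysis.
From mathcomp Require Import measurable_realfun ring lra zify.
Import Order.TTheory GRing.Theory Num.Theory.
Local Open Scope ring_scope.
Set Implicit Arguments. Unset Strict Implicit. Unset Printing Implicit Defensive.

(** * Packing of low-rank matrices *)

(** The obstacle is that contamination is paid for at every link of the chain. A Bernstein link at
    level [k] has variance of order [4^-k + eps]; with the parameter [tau 2^k / 2] it leaves a term
    [n tau eps 2^k], affordable only while [2^k tau <= 1], and the chain cannot end there since [U]
    ranges over a continuum. Past that scale links are no longer centred but counted, on a region
    where the mixture is at most [2 PB]: a multiplicative bound has no additive [eps] to repeat, so
    tiny Gaussian tails beat the entropy at every further level, however many there are. Nets built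
    from nets of the two factors would bring in the conditioning of [Sigma]; the Gram matrix
    argument works in the seminorm [|S vec U|] itself, even if it vanishes on some directions. Two
    values of [b] suffice because [x (z - x) >= 0] and [e >= b] give [e x z >= b x^2]: the event of
    an estimator at distance [e] lies in the event at distance [b], and no peeling over distances
    occurs. Exceptional events quantify over all [U], hence are bounded in outer probability
    ([small]). *)

(* Exponents of the monomials of degree [m] in the variables [V]. *)
Definition degree_set (V : finType) (m : nat) : {set {ffun V -> 'I_m.+1}} :=
  [set f : {ffun V -> 'I_m.+1} | (\sum_v f v)%N == m].

Lemma card_degree_set (V : finType) (g : nat) : (0 < g)%N ->
  (#|degree_set V (2 * (#|V| * g))| <= (8 * g) ^ #|V|)%N.
Proof.
move=> g0; set D := #|V|; set m := (2 * (D * g))%N.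
have g0r : 0 < (g%:R : rat) by rewrite ltr0n.
have g1r : 1 <= (g%:R : rat) by rewrite ler1n.
(* Weighting a monomial of degree [m] by [y ^+ m] turns the count into a product of
   geometric series. *)
pose y : rat := 1 - (4 * g%:R)^-1.
have i4 : (4 * g%:R : rat)^-1 <= 4^-1.
  by rewrite lef_pV2 ?posrE; lra.
have ip : 0 < (4 * g%:R : rat)^-1 by rewrite invr_gt0; lra.
have y0 : 0 < y by rewrite /y; lra.
have y1 : y < 1 by rewrite /y; lra.
have geo n : \sum_(j < n) y ^+ j <= 4 * g%:R.
  have := subrX1 y n; rewrite /y => h.
  have yn : 0 <= y ^+ n by rewrite exprn_ge0 ?ltW.
  suff : \sum_(j < n) y ^+ j * (4 * g%:R)^-1 <= 1.
    by rewrite -mulr_suml ler_pdivrMr ?mul1r //; lra.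
  rewrite -mulr_suml.
  have -> : (\sum_(i < n) y ^+ i) * (4 * g%:R)^-1 = 1 - y ^+ n.
    have -> : (4 * g%:R)^-1 = - (y - 1) by rewrite /y; ring.
    by rewrite mulrN mulrC -[X in - X](subrX1 y n); ring.
  lra.
(* By Bernoulli, [2 * g] factors losing [1 / (4 g)] each still leave one half. Hence the choice of
   [y]: [y ^+ m] costs only [2^-D], while each geometric sum is at most [4 g]. *)
have half : 2^-1 <= y ^+ (2 * g).
  suff H : forall n, 1 - n%:R * (4 * g%:R)^-1 <= y ^+ n.
    apply: le_trans (H _); rewrite natrM invfM.
    have : g%:R * g%:R^-1 = 1 :> rat by rewrite divff // gt_eqF.
    by move=> h; rewrite le_eqVlt; apply/orP; left; apply/eqP; nra.
  elim=> [|n IH]; first by rewrite expr0 mul0r subr0.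
  rewrite exprS; apply: le_trans (ler_wpM2l (ltW y0) IH).
  rewrite -natr1 /y.
  have := mulr_ge0 (ler0n rat n) (sqr_ge0 (4 * g%:R : rat)^-1).
  nra.
have main : (#|degree_set V m|)%:R * y ^+ m <= (4 * g%:R) ^+ D.
  rewrite mulr_natl -sumr_const.
  have -> : \sum_(i in degree_set V m) y ^+ m =
            \sum_(f in degree_set V m) \prod_v y ^+ f v.
    apply: eq_bigr => f; rewrite finset.inE => /eqP fm.
    by rewrite prodrXr fm.
  apply: (@le_trans _ _ (\sum_(f : {ffun V -> 'I_m.+1}) \prod_v y ^+ f v)).
    rewrite [leRHS](bigID (mem (degree_set V m))) /= lerDl sumr_ge0 // => f _.
    by rewrite prodr_ge0 // => v _; rewrite exprn_ge0 // ltW.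
  rewrite -(bigA_distr_bigA (fun v (j : 'I_m.+1) => y ^+ j)) /=.
  rewrite -prodr_const; apply: ler_prod => v _.
  rewrite geo andbT sumr_ge0 // => j _; by rewrite exprn_ge0 // ltW.
rewrite -(ler_nat rat) natrX natrM.
have ym : 2^-1 ^+ D <= y ^+ m.
  have -> : m = (2 * g * D)%N by rewrite /m; lia.
  by rewrite exprM lerXn2r // ?nnegrE ?exprn_ge0 // ltW.
have : (#|degree_set V m|)%:R * 2^-1 ^+ D <= (4 * g%:R) ^+ D :> rat.
  by apply: le_trans main; rewrite ler_wpM2l.
rewrite exprVn ler_pdivrMr ?exprn_gt0 // -exprMn.
by have -> : 4 * g%:R * 2 = 8%:R * g%:R :> rat by ring.
Qed.

(** The entry is a form of degree [2 * q] in the variables [th i], with coefficients depending on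
    [j] alone, so the matrix factors through the space indexed by the monomials of that degree. *)
Lemma rank_quadratic_pow (F : fieldType) (N q : nat) (E V : finType)
    (al be : E -> V) (th : 'I_N -> V -> F) (c : E -> 'I_N -> F) :
  (\rank (\matrix_(i, j)
     (\sum_e th i (al e) * th i (be e) * c e j) ^+ q : 'M[F]_N)
   <= #|degree_set V (2 * q)|)%N.
Proof.
set T := degree_set V (2 * q).
(* [f] picks one summand in each of the [q] factors of the expanded power; [cnt f v] is the exponent
   of [v] in the resulting monomial. *)
pose cnt (f : {ffun 'I_q -> E}) (v : V) :=
  (\sum_(l < q) ((al (f l) == v) + (be (f l) == v)))%N.
have cnt_le f v : (cnt f v < (2 * q).+1)%N.
  rewrite ltnS mulnC -[X in (X * 2)%N]card_ord -sum_nat_const leq_sum // => l _.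
  by case: (_ == v); case: (_ == v).
pose mf (f : {ffun 'I_q -> E}) : {ffun V -> 'I_(2 * q).+1} :=
  [ffun v => Ordinal (cnt_le f v)].
have mfT f : mf f \in T.
  rewrite finset.inE; apply/eqP.
  transitivity (\sum_v cnt f v)%N; first by apply: eq_bigr => v _; rewrite ffunE.
  rewrite exchange_big /= -[in RHS](card_ord q) mulnC -sum_nat_const.
  apply: eq_bigr => l _; rewrite big_split /=.
  have one (w : V) : (\sum_v (w == v) = 1)%N.
    rewrite (bigD1 w) //= eqxx big1 ?addn0 // => v /negbTE.
    by rewrite eq_sym => ->.
  by rewrite !one.
pose Th : 'M[F]_(N, #|T|) := \matrix_(i, m) \prod_v th i v ^+ ((enum_val m : {ffun V -> 'I_(2 * q).+1}) v).
pose C : 'M[F]_(#|T|, N) :=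
  \matrix_(m, j) \sum_(f | mf f == enum_val m) \prod_l c (f l) j.
suff -> : \matrix_(i, j) (\sum_e th i (al e) * th i (be e) * c e j) ^+ q
          = Th *m C.
  by apply: leq_trans (mxrankM_maxl _ _) _; exact: rank_leq_col.
apply/matrixP => i j; rewrite !mxE.
rewrite -[q in LHS]card_ord -prodr_const.
rewrite bigA_distr_bigA /=.
rewrite (partition_big mf (fun m => m \in T)) //= big_enum_val.
apply: eq_bigr => m _; rewrite !mxE big_distrr /=.
apply: eq_big => [f|f /eqP fm]; first by rewrite eq_sym.
rewrite big_split /=; congr (_ * _).
rewrite -fm.
rewrite (eq_bigr (fun l => \prod_v th i v ^+ ((al (f l) == v) + (be (f l) == v)))); last first.
  move=> l _.
  under eq_bigr do rewrite exprD.
  rewrite big_split /=; congr (_ * _).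
    rewrite (bigD1 (al (f l))) //= eqxx expr1 big1 ?mulr1 // => v /negbTE.
    by rewrite eq_sym => ->.
  rewrite (bigD1 (be (f l))) //= eqxx expr1 big1 ?mulr1 // => v /negbTE.
  by rewrite eq_sym => ->.
rewrite exchange_big /=; apply: eq_bigr => v _.
by rewrite ffunE /= /cnt prodrXr.
Qed.

(** Levy-Desplanques by columns: in [v *m A = 0], the coordinate where [v] is largest in absolute
    value cannot be balanced by the others. *)
Lemma row_free_diag_dominant (F : realFieldType) (N : nat) (A : 'M[F]_N) :
  (forall i, \sum_(j | j != i) `|A j i| < A i i) -> row_free A.
Proof.
move=> dd; rewrite -kermx_eq0; apply/eqP/row_matrixP => r; rewrite row0.
set v := row r _; have vA : v *m A = 0 by apply/sub_kermxP; exact: row_sub.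
apply/rowP => i0; rewrite [RHS]mxE; apply/eqP; apply: contraT => vi0.
have [i _ imax] := arg_maxP (fun i => `|v 0 i|) (isT : xpredT i0).
have vi : 0 < `|v 0 i|.
  by apply: lt_le_trans (imax i0 isT); rewrite normr_gt0.
have := congr1 (fun w : 'rV_N => w 0 i) vA; rewrite /= !mxE (bigD1 i) //= => /eqP.
rewrite addr_eq0 => /eqP h.
have Aii : 0 < A i i by apply: le_lt_trans (dd i); rewrite sumr_ge0.
have : `|v 0 i| * A i i <= `|v 0 i| * \sum_(j | j != i) `|A j i|.
  rewrite -[X in _ * X <= _](gtr0_norm Aii) -normrM h normrN mulr_sumr.
  apply: (le_trans (ler_norm_sum _ _ _)); apply: ler_sum => j _.
  by rewrite normrM ler_wpM2r //; exact: imax.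
by rewrite ler_pM2l // leNgt dd.
Qed.

Lemma rank_factor (F : fieldType) (p1 p2 k : nat) (U : 'M[F]_(p1, p2)) :
  (\rank U <= k)%N -> exists (G : 'M[F]_(p1, k)) (H : 'M[F]_(k, p2)), U = G *m H.
Proof.
move=> rk; exists (col_ebase U *m pid_mx (\rank U)).
exists (pid_mx (\rank U) *m row_ebase U).
rewrite -mulmxA (mulmxA (pid_mx _) (pid_mx _)) mul_pid_mx.
by rewrite minnn (minn_idPr rk) mulmxA mulmx_ebase.
Qed.

Lemma mxvec_dot (F : comNzRingType) (p1 p2 : nat) (A B : 'M[F]_(p1, p2)) :
  (mxvec A *m (mxvec B)^T) 0 0 = \sum_a \sum_b A a b * B a b.
Proof.
rewrite mxE (reindex _ (curry_mxvec_bij _ _)) /= pair_bigA /=.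
by apply: eq_bigr => -[a b] _; rewrite /= !mxE /= !mxvecE.
Qed.

(* Powers of the Gram matrix: [<t_i, t_j> ^+ q] is a polynomial of degree [2 q] in the
   [D] entries of the factors of [U_i], which bounds its rank; the off-diagonal powers
   are so small that it is invertible. *)
Lemma lowrank_packing (F : realFieldType) (p1 p2 k N h : nat)
    (us : 'I_N -> 'M[F]_(p1, p2)) (M : 'M[F]_(p1 * p2)) (delta : F) :
  let D := (k * (p1 + p2))%N in
  let dot U V := (mxvec U *m M *m (mxvec V)^T) 0 0 in
  0 < delta <= 1 -> 17 <= h%:R * delta ^+ 2 -> (0 < D)%N ->
  (forall i, \rank (us i) <= k)%N -> (forall i, dot (us i) (us i) = 1) ->
  (forall i j, i != j -> `|dot (us i) (us j)| <= 1 - delta) ->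
  (N <= (16 * h) ^ D)%N.
Proof.
move=> D dot /andP[d0 d1] hd D0 rk diag off.
have h0 : (0 < h)%N.
  rewrite lt0n; apply: contraTneq hd => ->; by rewrite mul0r -ltNge.
(* A family exceeding the bound contains one with exactly one element too many; its matrix would be
   invertible, yet of smaller rank. *)
wlog NE : N us rk diag off / N = ((16 * h) ^ D).+1.
  move=> W; rewrite leqNgt; apply/negP => lt.
  have := W _ (fun i => us (widen_ord lt i)).
  move=> H; suff : (((16 * h) ^ D).+1 <= (16 * h) ^ D)%N by rewrite ltnn.
  apply: H => // i j ij; apply: off; apply: contra ij => /eqP/(congr1 val)/= e.
  by apply/eqP/val_inj.
(* With this [q], the monomials of degree [2 * q] in [D] variables number at most
   [(8 g)^D = (16 h)^D]. *)
set g := (2 * h)%N; set q := (D * g)%N.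
have g16 : (16 * h = 8 * g)%N by rewrite /g; lia.
pose A : 'M[F]_N := \matrix_(i, j) dot (us i) (us j) ^+ q.
have rA : (\rank A <= (16 * h) ^ D)%N.
  have [G Gp] : exists G : 'I_N -> 'M[F]_(p1, k) * 'M[F]_(k, p2),
      forall i, us i = (G i).1 *m (G i).2.
    apply: (@fin_all_exists _ _ (fun i GH => us i = GH.1 *m GH.2)) => i.
    by have [G [H ->]] := rank_factor (rk i); exists (G, H).
  pose V : finType := ('I_p1 * 'I_k + 'I_k * 'I_p2)%type.
  pose th i (v : V) := match v with inl ac => (G i).1 ac.1 ac.2
                                  | inr cb => (G i).2 cb.1 cb.2 end.
  pose E : finType := ('I_p1 * 'I_k * 'I_p2)%type.
  pose W j : 'M[F]_(p1, p2) := vec_mx (M *m (mxvec (us j))^T)^T.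
  have dotE i j : dot (us i) (us j) = \sum_(e : E)
     th i (inl (e.1.1, e.1.2)) * th i (inr (e.1.2, e.2)) * W j e.1.1 e.2.
    rewrite /dot -mulmxA -[M *m _]trmxK -[(M *m _)^T]vec_mxK -/(W j).
    rewrite mxvec_dot.
    rewrite -(pair_bigA _ (fun ac b => th i (inl (ac.1, ac.2)) * th i (inr (ac.2, b)) * W j ac.1 b)) /=.
    rewrite -(pair_bigA _ (fun a c => \sum_b th i (inl (a, c)) * th i (inr (c, b)) * W j a b)) /=.
    apply: eq_bigr => a _; rewrite exchange_big /=; apply: eq_bigr => b _.
    by rewrite Gp !mxE big_distrl.
  have -> : A = \matrix_(i, j) (\sum_(e : E)
     th i (inl (e.1.1, e.1.2)) * th i (inr (e.1.2, e.2)) * W j e.1.1 e.2) ^+ q.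
    by apply/matrixP => i j; rewrite !mxE dotE.
  apply: leq_trans (rank_quadratic_pow q (fun e : E => inl (e.1.1, e.1.2) : V)
     (fun e => inr (e.1.2, e.2)) th (fun e j => W j e.1.1 e.2)) _.
  have cV : #|V| = D.
    by rewrite card_sum !card_prod !card_ord /D mulnDr mulnC.
  by rewrite g16 /q -cV; apply: card_degree_set; rewrite /g muln_gt0.
suff /eqP rN : row_free A by rewrite -rN.
apply: row_free_diag_dominant => i; rewrite !mxE diag expr1n.
have d1' : 0 <= 1 - delta by lra.
apply: (@le_lt_trans _ _ (\sum_(j | j != i) (1 - delta) ^+ q)).
  apply: ler_sum => j ji; rewrite mxE normrX lerXn2r ?nnegrE //.
  exact: off.
rewrite sumr_const.
have -> : #|(fun j => j != i)| = ((16 * h) ^ D)%N.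
  rewrite (_ : #|_| = #|predC1 i|); first by rewrite cardC1 card_ord {1}NE.
  by apply: eq_card => j; rewrite !finset.inE.
rewrite -mulr_natl natrX /q (mulnC D g) exprM -exprMn.
rewrite exprn_ilt1 ?lt0n_neq0 //; first by rewrite mulr_ge0 // exprn_ge0.
have bern n : 1 + n%:R * delta <= (1 + delta) ^+ n.
  elim: n => [|n IH]; first by rewrite mul0r addr0 expr0.
  rewrite exprS -natr1.
  have : 0 <= 1 + delta by lra.
  move/ler_wpM2l => /(_ _ _ IH); apply: le_trans.
  have := mulr_ge0 (ler0n F n) (sqr_ge0 delta); nra.
have hr : 1 <= h%:R :> F by rewrite ler1n.
(* The square of Bernoulli's bound contains [h (h delta^2)], which is at least [17 h]; together with
   [e1] this makes [16 h (1 - delta)^g] smaller than 1. *)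
have b2 : 16%:R * h%:R + 1 <= (1 + delta) ^+ g.
  rewrite /g mulnC exprM.
  apply: (@le_trans _ _ ((1 + h%:R * delta) ^+ 2)).
    have : 0 <= h%:R * (h%:R * delta ^+ 2 - 17) by rewrite mulr_ge0 // subr_ge0.
    have : 0 <= h%:R * delta by rewrite mulr_ge0 // ltW.
    rewrite !expr2; nra.
  have := bern h; have : 0 <= h%:R * delta by rewrite mulr_ge0 // ltW.
  move=> x y; rewrite lerXn2r ?nnegrE //; lra.
have e1 : (1 - delta) ^+ g * (1 + delta) ^+ g <= 1.
  rewrite -exprMn; apply: exprn_ile1; [nra|].
  have := sqr_ge0 delta; rewrite expr2; nra.
have p0 : 0 <= (1 - delta) ^+ g by rewrite exprn_ge0.
have [->|pp] := eqVneq ((1 - delta) ^+ g) 0; first by rewrite mulr0.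
have p1' : 0 < (1 - delta) ^+ g by rewrite lt0r pp.
rewrite natrM.
have := ler_wpM2l p0 b2; nra.
Qed.

(** * Euclidean inner product and norm of columns *)

Section euclid.
Context {R : realType}.

Definition dotv (m : nat) (u v : 'cV[R]_m) : R := (u^T *m v) 0 0.

Lemma dotvE m (u v : 'cV[R]_m) : dotv u v = \sum_k u k 0 * v k 0.
Proof. by rewrite /dotv mxE; apply: eq_bigr => k _; rewrite mxE. Qed.

Lemma dotvC m (u v : 'cV[R]_m) : dotv u v = dotv v u.
Proof. by rewrite !dotvE; apply: eq_bigr => k _; rewrite mulrC. Qed.

Lemma dotvDl m (u u' v : 'cV[R]_m) : dotv (u + u') v = dotv u v + dotv u' v.
Proof. by rewrite /dotv linearD mulmxDl mxE. Qed.

Lemma dotvZl m a (u v : 'cV[R]_m) : dotv (a *: u) v = a * dotv u v.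
Proof. by rewrite /dotv linearZ -scalemxAl mxE. Qed.

Lemma dotvNl m (u v : 'cV[R]_m) : dotv (- u) v = - dotv u v.
Proof. by rewrite -scaleN1r dotvZl mulN1r. Qed.

Lemma dotvBl m (u u' v : 'cV[R]_m) : dotv (u - u') v = dotv u v - dotv u' v.
Proof. by rewrite dotvDl dotvNl. Qed.

Lemma dotvBr m (u v v' : 'cV[R]_m) : dotv u (v - v') = dotv u v - dotv u v'.
Proof. by rewrite dotvC dotvBl !(dotvC u). Qed.

Lemma dotvZr m a (u v : 'cV[R]_m) : dotv u (a *: v) = a * dotv u v.
Proof. by rewrite dotvC dotvZl dotvC. Qed.

Lemma dotvDr m (u v v' : 'cV[R]_m) : dotv u (v + v') = dotv u v + dotv u v'.
Proof. by rewrite dotvC dotvDl !(dotvC u). Qed.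

Lemma enorm_ge0 m (u : 'cV[R]_m) : 0 <= enorm u.
Proof. exact: sqrtr_ge0. Qed.

Lemma sqr_enorm m (u : 'cV[R]_m) : enorm u ^+ 2 = dotv u u.
Proof.
rewrite sqr_sqrtr ?dotvE; first by apply: eq_bigr => k _; rewrite expr2.
by apply: sumr_ge0 => k _; rewrite sqr_ge0.
Qed.

Lemma enormZ m a (u : 'cV[R]_m) : enorm (a *: u) = `|a| * enorm u.
Proof.
apply/eqP; rewrite -(@eqrXn2 _ 2) ?enorm_ge0 ?mulr_ge0 ?enorm_ge0 //.
by rewrite exprMn !sqr_enorm dotvZl dotvZr mulrA -expr2 real_normK ?num_real.
Qed.

Lemma enormN m (u : 'cV[R]_m) : enorm (- u) = enorm u.
Proof. by rewrite -scaleN1r enormZ normrN normr1 mul1r. Qed.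

Lemma enorm_eq0 m (u : 'cV[R]_m) : enorm u = 0 -> u = 0.
Proof.
move=> u0; have := sqr_enorm u; rewrite u0 expr0n /= dotvE => /esym/eqP.
rewrite psumr_eq0 => [/allP h|k _]; last by rewrite -expr2 sqr_ge0.
apply/colP => k; rewrite mxE.
by have := h k (mem_index_enum _); rewrite /= mulf_eq0 orbb => /eqP.
Qed.

Lemma dotv_le m (u v : 'cV[R]_m) : `|dotv u v| <= enorm u * enorm v.
Proof.
have [v0|v0] := eqVneq (enorm v) 0.
  by rewrite (enorm_eq0 v0) /dotv mulmx0 mxE normr0 mulr_ge0 ?enorm_ge0.
have vp : 0 < enorm v by rewrite lt0r v0 enorm_ge0.
rewrite -(@ler_sqr _ _ (_ * _)) ?nnegrE ?mulr_ge0 ?enorm_ge0 //.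
rewrite real_normK ?num_real // exprMn.
have := sqr_ge0 (enorm (enorm v ^+ 2 *: u - dotv u v *: v)).
rewrite (sqr_enorm (_ - _)) !(dotvBl, dotvBr, dotvZl, dotvZr) -!sqr_enorm.
rewrite (dotvC v u) => h.
have : 0 <= enorm v ^+ 2 * (enorm u ^+ 2 * enorm v ^+ 2 - dotv u v ^+ 2) by nra.
by rewrite pmulr_rge0 ?exprn_gt0 // subr_ge0.
Qed.

Lemma enormD m (u v : 'cV[R]_m) : enorm (u + v) <= enorm u + enorm v.
Proof.
rewrite -(@ler_sqr _ _ (_ + _)) ?nnegrE ?addr_ge0 ?enorm_ge0 //.
rewrite sqr_enorm !(dotvDl, dotvDr) -!sqr_enorm (dotvC v u).
have := le_trans (ler_norm _) (dotv_le u v); nra.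
Qed.

Lemma enormB m (u v : 'cV[R]_m) : enorm (u - v) <= enorm u + enorm v.
Proof. by apply: le_trans (enormD _ _) _; rewrite enormN. Qed.

End euclid.

(** * Nets of low-rank directions in the seminorm of [S] *)

Section nets.
Context {R : realType} (p1 p2 k : nat) (S : 'M[R]_(p1 * p2)).

(** The unit sphere of the seminorm; directions killed by [S] are absent from it and get a separate
    argument in the depth of [B]. *)
Definition unit_lowrank (U : 'M[R]_(p1, p2)) : Prop :=
  (\rank U <= k)%N /\ enorm (S *m vecc U) = 1.

Lemma unit_lowrankN U : unit_lowrank U -> unit_lowrank (- U).
Proof.
move=> [rU nU]; split; first by rewrite mxrank_opp.
have -> : vecc (- U) = - vecc U by rewrite /vecc !linearN.
by rewrite mulmxN enormN.
Qed.

Lemma dotv_gram (U V : 'M[R]_(p1, p2)) :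
  (mxvec U *m (S^T *m S) *m (mxvec V)^T) 0 0 = dotv (S *m vecc U) (S *m vecc V).
Proof. by rewrite /dotv /vecc trmx_mul trmxK !mulmxA. Qed.

(** A maximal family whose pairwise products are at most [1 - delta] in absolute value covers every
    direction up to sign. The net is this family with its opposites, whence the factor 2. *)
Lemma lowrank_net (j : nat) : (0 < k * (p1 + p2))%N ->
  exists s : seq 'M[R]_(p1, p2),
  [/\ forall V, V \in s -> unit_lowrank V,
      (size s <= 2 * 256 ^ (2 * j.+1 * (k * (p1 + p2))))%N &
      forall U, unit_lowrank U -> exists2 V, V \in s &
        enorm (S *m vecc U - S *m vecc V) <= 16 ^- j].
Proof.
move=> D0; set D := (k * (p1 + p2))%N in D0 *.
pose dot U V := dotv (S *m vecc U) (S *m vecc V).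
(* With the right sign in front of [V], the squared distance is
   [2 - 2 |dot U V| < 2 delta = (16^-j)^2]. *)
pose delta : R := (2 * 256 ^+ j)^-1.
have p256 : 1 <= (256 ^+ j : R) by apply: exprn_ege1; lra.
have d01 : 0 < delta <= 1.
  by rewrite /delta invr_gt0 invf_le1 ?mulr_gt0; lra.
pose P N := `[< exists us : 'I_N -> 'M[R]_(p1, p2),
  (forall i, unit_lowrank (us i)) /\
  forall i i', i != i' -> `|dot (us i) (us i')| <= 1 - delta >].
have PB N : P N -> (N <= 256 ^ (2 * j.+1 * D))%N.
  move=> /asboolP [us [uu off]].
  (* [h = 68 * 256^(2 j)] gives exactly [h delta^2 = 17]. *)
  apply: (@leq_trans ((16 * (68 * 256 ^ (2 * j))) ^ D)).
    apply: (@lowrank_packing R p1 p2 k N _ us (S^T *m S) delta) => //.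
    - rewrite natrM natrX /delta exprVn exprMn -exprM mulnC.
      have : 0 < (256 ^+ (2 * j) : R) by rewrite exprn_gt0.
      rewrite (mulnC 2%N j); move: (256 ^+ _) => x x0.
      rewrite ler_pdivlMr; [lra|by rewrite mulr_gt0].
    - by move=> i; have [] := uu i.
    - by move=> i; rewrite dotv_gram -sqr_enorm; have [_ ->] := uu i; rewrite expr1n.
    - by move=> i i' ii'; rewrite dotv_gram; apply: off.
  rewrite [X in (_ <= X)%N]expnM leq_exp2r // mulnS expnD mulnA.
  by apply: leq_mul => //; rewrite expnS expn1; apply: leq_mul.
have P0 : exists N, P N.
  exists 0%N; apply/asboolP; exists (fun _ => 0); split; by case.
case: (ex_maxnP P0 PB) => N /asboolP [us [uu off]] maxN.
exists (codom us ++ codom (fun i => - us i)); split.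
- move=> V; rewrite mem_cat => /orP[] /codomP [i ->]; first exact: uu.
  exact: unit_lowrankN.
- rewrite size_cat !size_codom card_ord addnn -mul2n leq_mul2l /=.
  by apply: PB; apply/asboolP; exists us.
move=> U uU.
have [i hi] : exists i, 1 - delta < `|dot U (us i)|.
  apply: contrapT => h.
  suff : P N.+1 by move=> /maxN; rewrite ltnn.
  have hU i0 : `|dot U (us i0)| <= 1 - delta.
    by rewrite leNgt; apply/negP => c; apply: h; exists i0.
  apply/asboolP; exists (fun i => oapp us U (unlift ord0 i)); split.
    by move=> i; case: unliftP => [a|] _ /=.
  move=> i i'; case: unliftP => [a ->|->]; case: unliftP => [b ->|->] //= ab.
  - by apply: off; apply: contra ab => /eqP ->.
  - by rewrite /dot dotvC; apply: hU.
have key (e : R) : e ^+ 2 = 1 -> e * dot U (us i) = `|dot U (us i)| ->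
    enorm (S *m vecc U - e *: (S *m vecc (us i))) <= 16 ^- j.
  move=> e2 ee.
  have p16 : 0 < (16 ^+ j : R) by rewrite exprn_gt0.
  rewrite -(@ler_sqr _ _ (16 ^- j)) ?nnegrE ?enorm_ge0 ?invr_ge0 ?(ltW p16) //.
  rewrite sqr_enorm !(dotvBl, dotvBr, dotvZl, dotvZr) -!sqr_enorm.
  rewrite (dotvC (S *m vecc (us i))) -/(dot U (us i)) ee.
  have [_ ->] := uU; have [_ ->] := uu i; rewrite expr1n mulr1.
  rewrite mulrBr ee -(expr2 e) e2.
  have -> : (16 ^- j) ^+ 2 = 2 * delta :> R.
    rewrite /delta exprVn -exprM mulnC exprM.
    have -> : 16 ^+ 2 = 256 :> R by rewrite expr2; ring.
    by rewrite invfM mulrA divff // mul1r.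
  by lra.
have [s0|s0] := leP 0 (dot U (us i)).
  exists (us i); first by rewrite mem_cat codom_f.
  have := key 1; rewrite expr1n scale1r mul1r; apply=> //; by rewrite ger0_norm.
exists (- us i); first by rewrite mem_cat (codom_f (fun i => - us i)) orbT.
have := key (-1); rewrite sqrrN expr1n scaleN1r mulN1r.
have -> : vecc (- us i) = - vecc (us i) by rewrite /vecc !linearN.
by rewrite mulmxN; apply=> //; rewrite ltr0_norm.
Qed.

End nets.

Local Open Scope classical_set_scope.

(** * Events, empirical counts and exponential bounds *)

Section pr.
Context {R : realType} {d : measure_display} {T : measurableType d}.
Implicit Types (P : probability T R) (A B : set T).

Definition pr P A : R := fine (P A).

Lemma prE P A : measurable A -> P A = (pr P A)%:E.
Proof. by move=> mA; rewrite /pr fineK // fin_num_measure. Qed.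

Lemma pr_ge0 P A : 0 <= pr P A.
Proof. by rewrite /pr fine_ge0. Qed.

Lemma pr_le P A B : measurable A -> measurable B -> A `<=` B -> pr P A <= pr P B.
Proof. by move=> mA mB AB; rewrite -lee_fin -!prE // le_measure ?inE. Qed.

Lemma prT P : pr P setT = 1.
Proof. by rewrite /pr probability_setT. Qed.

Lemma pr0 P : pr P set0 = 0.
Proof. by rewrite /pr measure0. Qed.

Lemma pr_le1 P A : measurable A -> pr P A <= 1.
Proof. by move=> mA; rewrite -(prT P); apply: pr_le. Qed.

Lemma prU P A B : measurable A -> measurable B -> pr P (A `|` B) <= pr P A + pr P B.
Proof.
move=> mA mB; rewrite -lee_fin EFinD -!prE //; last exact: measurableU.
exact: measureU2.
Qed.

Lemma prDI P A B : measurable A -> measurable B ->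
  pr P A = pr P (A `&` B) + pr P (A `\` B).
Proof.
move=> mA mB; have mI := measurableI _ _ mA mB; have mD := measurableD mA mB.
by apply: EFin_inj; rewrite EFinD -!prE // [LHS](measureDI P mA mB) addeC.
Qed.

Lemma prC P A : measurable A -> pr P (~` A) = 1 - pr P A.
Proof.
move=> mA; rewrite -(prT P) (@prDI P setT A) //.
by rewrite setTI setTD; ring.
Qed.

Lemma pr_union_seq P (I : eqType) (s : seq I) (A : I -> set T) :
  (forall i, i \in s -> measurable (A i)) ->
  measurable [set x | exists2 i, i \in s & A i x] /\
  pr P [set x | exists2 i, i \in s & A i x] <= \sum_(i <- s) pr P (A i).
Proof.
elim: s => [|i s IH] mA.
  rewrite big_nil (_ : [set _ | _] = set0); first by split => //; rewrite pr0.
  by rewrite -subset0 => x [].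
have [|mI leI] := IH.
  by move=> j js; apply: mA; rewrite inE js orbT.
have mi : measurable (A i) by apply: mA; rewrite mem_head.
rewrite big_cons.
rewrite (_ : [set x | exists2 j, j \in i :: s & A j x] =
   A i `|` [set x | exists2 i, i \in s & A i x]).
  split; first exact: measurableU.
  by apply: le_trans (prU _ _ _) _ => //; rewrite lerD2l.
apply/seteqP; split => x /=.
  by move=> [j]; rewrite inE => /orP[/eqP ->|js]; [left|right; exists j].
by move=> [Ai|[j js Aj]]; [exists i; rewrite ?mem_head|exists j; rewrite // inE js orbT].
Qed.

Lemma measurable_forall (I : finType) (A : I -> set T) :
  (forall i, measurable (A i)) -> measurable [set x | forall i, A i x].
Proof.
move=> mA; rewrite (_ : [set _ | _] = \bigcap_(i in setT) A i).
  by apply: fin_bigcap_measurable => // i _; exact: mA.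
by apply/seteqP; split => x /= h i; [move=> _; exact: h|exact: h].
Qed.

End pr.

Definition iid {R : realType} {d : measure_display} {T : measurableType d} (n : nat)
    (Prob : probability (n.-tuple T) R) (mu : probability T R) : Prop :=
  forall A : 'I_n -> set T, (forall i, measurable (A i)) ->
    pr Prob [set s | forall i, A i (tnth s i)] = \prod_i pr mu (A i).

Section chernoff.
Context {R : realType} {d : measure_display} {T : measurableType d} (n : nat).
Context (Prob : probability (n.-tuple T) R) (mu : probability T R).
Context (hiid : iid Prob mu).

Lemma measurable_tnth_preimage (i : 'I_n) (A : set T) : measurable A ->
  measurable [set s : n.-tuple T | A (tnth s i)].
Proof.
move=> mA; have := @measurable_tnth _ T n i measurableT A mA.
by rewrite setTI.
Qed.

(** The statistic takes finitely many values, so its event is a finite union of label patterns: it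
    is measurable, and the exponential moment factorises by distributing a product over a finite
    sum, without any integral on the product space. *)
Lemma chernoff_label (F : finType) (l : T -> F) (wt : F -> R) (u : R) :
  (forall v, measurable (l @^-1` [set v])) ->
  let E := [set s : n.-tuple T | u <= \sum_i wt (l (tnth s i))] in
  measurable E /\
  pr Prob E <= expR (- u) * (\sum_v expR (wt v) * pr mu (l @^-1` [set v])) ^+ n.
Proof.
move=> ml E.
pose B (f : {ffun 'I_n -> F}) := [set s : n.-tuple T | forall i, l (tnth s i) = f i].
pose s := [seq f : {ffun 'I_n -> F} <- index_enum {ffun 'I_n -> F} | u <= \sum_i wt (f i)].
have EB : E = [set x | exists2 f, f \in s & B f x].
  apply/seteqP; split => x /=.
    move=> ux; exists [ffun i => l (tnth x i)]; last by move=> i; rewrite ffunE.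
    rewrite mem_filter mem_index_enum andbT.
    by under eq_bigr do rewrite ffunE.
  move=> [f]; rewrite mem_filter => /andP[uf _] Bf.
  by rewrite /E /=; under eq_bigr do rewrite Bf.
have mB f : measurable (B f).
  apply: (@measurable_forall _ _ 'I_n (fun i => [set s | l (tnth s i) = f i])) => i.
  exact: (measurable_tnth_preimage i (ml (f i))).
have [mE leE] := @pr_union_seq _ _ _ Prob _ s B (fun f _ => mB f).
rewrite EB; split => //; apply: le_trans leE _.
have BE f : pr Prob (B f) = \prod_i pr mu (l @^-1` [set f i]).
  by rewrite -(hiid (A := fun i => l @^-1` [set f i])).
rewrite big_filter.
apply: (@le_trans _ _ (\sum_(f : {ffun 'I_n -> F}) expR (- u) *
    \prod_i (expR (wt (f i)) * pr mu (l @^-1` [set f i])))).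
  rewrite big_mkcond /=; apply: ler_sum => f _.
  rewrite big_split /= -BE.
  case: ifP => [uf|_]; last first.
    by rewrite !mulr_ge0 ?expR_ge0 ?pr_ge0 // prodr_ge0 // => i _; rewrite expR_ge0.
  rewrite mulrA ler_peMl ?pr_ge0 //.
  by rewrite -expR_sum -expRD -[X in X <= _]expR0 ler_expR addrC subr_ge0.
rewrite -mulr_sumr -[X in _ ^+ X]card_ord -prodr_const.
by rewrite -(bigA_distr_bigA (fun _ v => expR (wt v) * pr mu (l @^-1` [set v]))).
Qed.

End chernoff.

(** * Bounds in outer probability *)

Section small_sets.
Context {R : realType} {d : measure_display} {T : measurableType d}.
Context (P : probability T R).

(** A measurable cover of mass at most [e]: events quantified over uncountably many directions can
    be treated without showing that they are measurable. *)
Definition small (e : R) (F : set T) : Prop :=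
  exists F', [/\ measurable F', F `<=` F' & pr P F' <= e].

Lemma small_sub e e' (F F' : set T) : F' `<=` F -> e <= e' -> small e F -> small e' F'.
Proof.
move=> FF ee [G [mG FG Ge]]; exists G; split => //.
- exact: subset_trans FG.
- exact: le_trans ee.
Qed.

Lemma small_measurable e (F : set T) : measurable F -> pr P F <= e -> small e F.
Proof. by move=> mF Fe; exists F; split. Qed.

Lemma small0 : small 0 set0.
Proof. by exists set0; split => //; rewrite pr0. Qed.

Lemma smallU e e' (F F' : set T) : small e F -> small e' F' -> small (e + e') (F `|` F').
Proof.
move=> [G [mG FG Ge]] [G' [mG' FG' Ge']]; exists (G `|` G'); split.
- exact: measurableU.
- exact: setUSS.
- by apply: le_trans (prU _ mG mG') _; rewrite lerD.
Qed.

Lemma small_seq (I : eqType) (s : seq I) (e : R) (F : I -> set T) :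
  (forall i, i \in s -> small e (F i)) ->
  small ((size s)%:R * e) [set x | exists2 i, i \in s & F i x].
Proof.
elim: s => [|i s IH] sF.
  by rewrite mul0r; apply: small_sub small0 => // x [].
have hs : small ((size s)%:R * e) [set x | exists2 i, i \in s & F i x].
  by apply: IH => j js; apply: sF; rewrite inE js orbT.
apply: small_sub (smallU (sF i (mem_head _ _)) hs).
  by move=> x [j]; rewrite inE => /orP[/eqP ->|js] Fj; [left|right; exists j].
by rewrite /= -natr1 mulrDl mul1r addrC.
Qed.

(** The weights sum to less than 1, so the bound does not depend on the number [m] of levels. *)
Lemma small_levels (m : nat) (e : R) (F : nat -> set T) : 0 <= e ->
  (forall k, (k < m)%N -> small (e * 2^-1 ^+ k.+1) (F k)) ->
  small e [set x | exists2 k, (k < m)%N & F k x].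
Proof.
move=> e0 sF.
suff : small (e * (1 - 2^-1 ^+ m)) [set x | exists2 k, (k < m)%N & F k x].
  apply: small_sub => //; rewrite ler_piMr // gerBl; by rewrite exprn_ge0.
elim: m sF => [|m IH] sF.
  by rewrite expr0 subrr mulr0; apply: small_sub small0 => // x [].
have hs := IH (fun k km => sF k (leqW km)).
apply: small_sub (smallU (sF m (ltnSn m)) hs).
  move=> x [k]; rewrite ltnS leq_eqVlt => /orP[/eqP ->|km] Fk; [by left|].
  by right; exists k.
rewrite -mulrDr ler_wpM2l // exprS; lra.
Qed.

End small_sets.

(** * The contaminated law *)

Section mixture.
Context {R : realType} {d : measure_display} {T : measurableType d}.
Implicit Types P Q mu : probability T R.

Lemma mixture_exists P Q (eps : R) : 0 <= eps <= 1 ->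
  exists mu : probability T R, forall A : set T,
    mu A = ((1 - eps)%:E * P A + eps%:E * Q A)%E.
Proof.
move=> /andP[e0 e1]; have e1' : 0 <= 1 - eps by rewrite subr_ge0.
pose m : {measure set T -> \bar R} := measure_add (mscale (NngNum e1') P) (mscale (NngNum e0) Q).
have mE A : m A = ((1 - eps)%:E * P A + eps%:E * Q A)%E.
  exact: measure_addE.
have mT : m setT = 1%E.
  by rewrite mE [P _]probability_setT [Q _]probability_setT !mule1 -EFinD; congr EFin; ring.
(* [m] already has mass 1; normalising it only packages it as a probability. *)
exists (mnormalize m P) => A.
change (mnormalize m P A = (1 - eps)%:E * P A + eps%:E * Q A)%E.
by rewrite /mnormalize mT onee_eq0 /= invr1 mule1 mE.
Qed.

Lemma mixture_pr P Q mu eps A : measurable A ->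
  mu A = ((1 - eps)%:E * P A + eps%:E * Q A)%E ->
  pr mu A = (1 - eps) * pr P A + eps * pr Q A.
Proof. by move=> mA muE; rewrite {1}/pr muE !prE. Qed.

(* [G] is the positive part of the Hahn decomposition of [(1 - eps) P - eps Q]: it stands
   for the uncontaminated observations, without any coupling. *)
Lemma clean_region P Q mu eps : 0 <= eps <= 1 ->
  (forall A, measurable A -> pr mu A = (1 - eps) * pr P A + eps * pr Q A) ->
  exists G, [/\ measurable G, pr mu (~` G) <= 2 * eps &
    forall A, measurable A -> pr mu (A `&` G) <= 2 * pr P A].
Proof.
move=> /andP[e0 e1] muE.
pose nu : {charge set T -> \bar R} := cadd (cscale (1 - eps) (charge_of_finite_measure P))
                (cscale (- eps) (charge_of_finite_measure Q)).
have nuE A : measurable A -> nu A = ((1 - eps) * pr P A - eps * pr Q A)%:E.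
  move=> mA; change (nu A) with ((1 - eps)%:E * P A + (- eps)%:E * Q A)%E.
  by rewrite !prE // -!EFinM -EFinD mulNr.
have [G [N [[mG posG] [mN negN] GN GN0]]] := Hahn_decomposition nu.
have NC : ~` G = N.
  apply/seteqP; split => x.
    by move=> nG; have [] : (G `|` N) x by rewrite GN.
  by move=> Nx Gx; have : (G `&` N) x by []; rewrite GN0.
exists G; split => //.
  rewrite NC muE //; have := negN N mN (@subset_refl _ N).
  rewrite nuE // lee_fin => h.
  have := ler_wpM2l e0 (pr_le1 Q mN); lra.
move=> A mA; have mAG := measurableI _ _ mA mG.
have := posG _ mAG (@subIsetr _ A G); rewrite nuE // lee_fin => h.
rewrite muE //.
have := pr_le P mAG mA (@subIsetl _ A G).
have : 0 <= 1 - eps by lra.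
move=> e1' /(ler_wpM2l e1'); have := mulr_ge0 e0 (pr_ge0 P A); nra.
Qed.

End mixture.

Lemma iid_of_mixture {R : realType} (p1 p2 n : nat)
    (Prob : probability (n.-tuple (Obs p1 p2)) R)
    (PB Q mu : probability (Obs p1 p2) R) (eps : R) :
  (forall A, mu A = ((1 - eps)%:E * PB A + eps%:E * Q A)%E) ->
  iid_mixture Prob PB Q eps -> iid Prob mu.
Proof.
move=> muE [margin prod] A mA.
apply: EFin_inj; rewrite -prodEFin -prE; last first.
  apply: (@measurable_forall _ _ 'I_n (fun i => [set s | A i (tnth s i)])) => i.
  exact: measurable_tnth_preimage.
rewrite prod //; apply: eq_bigr => i _.
by rewrite margin // -muE prE.
Qed.

(** * The normal law *)

Section normal.
Context {R : realType}.
Local Notation mu := (@lebesgue_measure R).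

Lemma measurable_normal_pdfE (m s : R) (D : set R) :
  measurable_fun D (EFin \o normal_pdf m s).
Proof. by apply/measurable_EFinP/measurable_funTS; exact: measurable_normal_pdf. Qed.

Local Notation shift m := ((fun x : R => x + m) : measurableTypeR R -> measurableTypeR R).

Lemma lebesgue_measure_shift (m : R) (A : set R) : measurable A ->
  pushforward mu (shift m) A = mu A.
Proof.
move=> mA; apply/esym/lebesgue_measure_unique => //=.
  exact: measurable_funD.
move=> _ _ [[a b]] _ <-.
rewrite /pushforward (_ : _ @^-1` _ = `]a - m, b - m]%classic); last first.
  by apply/seteqP; split => x /=; rewrite !in_itv /= ltrBlDr lerBrDr.
rewrite !lebesgue_measure_itv /= !lte_fin ltrD2r; case: ifP => // _.
by rewrite -!EFinD; congr EFin; ring.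
Qed.

Lemma normal_prob_shift (m s : R) (C : set R) : s != 0 -> measurable C ->
  normal_prob m s C = normal_prob 0 s [set z | C (z + m)].
Proof.
move=> s0 mC; rewrite /normal_prob.
have mf : measurable_fun setT (shift m).
  exact: measurable_funD.
transitivity (\int[pushforward mu (shift m)]_(x in C)
    (normal_pdf m s x)%:E)%E.
  by apply: eq_measure_integral => /= A mA _; exact/esym/lebesgue_measure_shift.
rewrite (ge0_integral_pushforward mf _ mC (@measurable_normal_pdfE m s C)).
- apply: eq_integral => x _ /=; congr EFin.
  by rewrite !normal_pdfE // normal_fun_center /= [in RHS]/normal_fun /= addrK subr0 /normal_fun /= subr0.
- by move=> y _; rewrite lee_fin normal_pdf_ge0.
Qed.

Lemma normal_probN (s : R) (C : set R) : s != 0 -> measurable C ->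
  normal_prob 0 s C = normal_prob 0 s [set z | C (- z)].
Proof.
move=> s0 mC; rewrite /normal_prob.
transitivity (\int[pushforward mu (-%R : measurableTypeR R -> measurableTypeR R)]_(x in C)
    (normal_pdf 0 s x)%:E)%E.
  by apply: eq_measure_integral => /= A mA _; exact/esym/lebesgue_measureN.
have mf : measurable_fun setT (-%R : measurableTypeR R -> measurableTypeR R) by [].
rewrite (ge0_integral_pushforward mf _ mC (@measurable_normal_pdfE 0 s C)).
- apply: eq_integral => x _ /=; congr EFin.
  by rewrite !normal_pdfE // /normal_fun !subr0 sqrrN.
- by move=> y _; rewrite lee_fin normal_pdf_ge0.
Qed.

(** From [2 <= pi <= 4] one gets [(2 s)^2 <= 2 pi s^2 <= (3 s)^2]. *)
Lemma normal_peak_bounds (s : R) : 0 < s -> (3 * s)^-1 <= normal_peak s <= (2 * s)^-1.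
Proof.
move=> s0; rewrite /normal_peak.
have pi2 := @pihalf_ge1 R; have pi4 := @pihalf_lt2 R.
have h : (2 * s) ^+ 2 <= s ^+ 2 * pi *+ 2 <= (3 * s) ^+ 2.
  have q0 := exprn_gt0 2 s0; rewrite !exprMn mulr2n.
  have h2 : 0 <= s ^+ 2 * (pi - 2) by rewrite mulr_ge0 ?(ltW q0) //; lra.
  have h4 : 0 <= s ^+ 2 * (4 - pi) by rewrite mulr_ge0 ?(ltW q0) //; lra.
  have e4 : 2 ^+ 2 = 4 :> R by rewrite expr2; ring.
  have e9 : 3 ^+ 2 = 9 :> R by rewrite expr2; ring.
  by rewrite e4 e9; lra.
have p0 : 0 < Num.sqrt (s ^+ 2 * pi *+ 2).
  rewrite sqrtr_gt0; case/andP: h => h _; apply: lt_le_trans h.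
  by rewrite exprn_gt0 // mulr_gt0.
case/andP: h => h1 h2.
have s2 : 0 <= 2 * s by rewrite mulr_ge0 // ltW.
have s3 : 0 <= 3 * s by rewrite mulr_ge0 // ltW.
rewrite !lef_pV2 ?posrE ?mulr_gt0 //; apply/andP; split.
  by rewrite -(ger0_norm s3) -sqrtr_sqr ler_wsqrtr.
by rewrite -(ger0_norm s2) -sqrtr_sqr ler_wsqrtr.
Qed.

Lemma measurable_le (a : R) : measurable [set x : R | x <= a].
Proof.
by rewrite (_ : [set _ | _] = `]-oo, a]%classic); [|apply/seteqP; split => x /=; rewrite in_itv].
Qed.

Lemma measurable_ge (a : R) : measurable [set x : R | a <= x].
Proof.
by rewrite (_ : [set _ | _] = `[a, +oo[%classic);
  [|apply/seteqP; split => x /=; rewrite in_itv /= andbT].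
Qed.

Lemma measurable_gt (a : R) : measurable [set x : R | a < x].
Proof.
by rewrite (_ : [set _ | _] = `]a, +oo[%classic);
  [|apply/seteqP; split => x /=; rewrite in_itv /= andbT].
Qed.

Lemma measurable_between (a b : R) : measurable [set x : R | a <= x <= b].
Proof.
by rewrite (_ : [set _ | _] = `[a, b]%classic); [|apply/seteqP; split => x /=; rewrite in_itv].
Qed.

Lemma measurable_norm_ge (a : R) : measurable [set x : R | a <= `|x|].
Proof.
rewrite (_ : [set _ | _] = [set x | a <= x] `|` [set x | x <= - a]).
  by apply: measurableU; [exact: measurable_ge|exact: measurable_le].
apply/seteqP; split => x /=; rewrite ler_normr lerNr.
  by move=> /orP[]; [left|right].
by move=> [->|->]; rewrite ?orbT.
Qed.

Lemma lebesgue_between (a b : R) : a <= b ->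
  mu [set x : R | a <= x <= b] = (b - a)%:E.
Proof.
move=> ab; rewrite (_ : [set _ | _] = `[a, b]%classic); last first.
  by apply/seteqP; split => x /=; rewrite in_itv.
rewrite lebesgue_measure_itv /= lte_fin; case: ltP => [_|ba]; first by rewrite EFinB.
by rewrite (_ : b - a = 0) //; apply/eqP; rewrite subr_eq0 eq_le ab ba.
Qed.

Lemma pr_normal_between_le (m s a b : R) : 0 < s -> a <= b ->
  pr (normal_prob m s) [set x | a <= x <= b] <= (b - a) / (2 * s).
Proof.
move=> s0 ab; have mI := measurable_between a b.
pose c := (2 * s)^-1; rewrite -lee_fin -prE //= /normal_prob.
apply: (@le_trans _ _ (\int[mu]_(x in [set x | (a <= x <= b)%R]) (cst (c%:E) x))%E).
  apply: ge0_le_integral => //=.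
  - by move=> x _; rewrite lee_fin normal_pdf_ge0.
  - exact: measurable_normal_pdfE.
  - move=> x _; rewrite lee_fin; apply: le_trans (normal_pdf_ub _ _ _) _.
      by rewrite gt_eqF.
    by case/andP: (normal_peak_bounds s0).
by rewrite integral_cst //= lebesgue_between // -EFinM mulrC.
Qed.

Lemma pr_normal_between_ge (s t : R) : 0 <= t <= s -> 0 < s ->
  t / (6 * s) <= pr (normal_prob 0 s) [set x | 0 <= x <= t].
Proof.
move=> /andP[t0 ts] s0; have mI := measurable_between 0 t.
pose c := (6 * s)^-1; rewrite -lee_fin -prE //= /normal_prob.
apply: (@le_trans _ _ (\int[mu]_(x in [set x | (0 <= x <= t)%R]) (cst (c%:E) x))%E).
  by rewrite integral_cst //= lebesgue_between // subr0 -EFinM mulrC.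
apply: ge0_le_integral => //=.
- by move=> x _; rewrite lee_fin invr_ge0 mulr_ge0 // ltW.
- exact: measurable_normal_pdfE.
move=> x /= /andP[x0 xt]; rewrite lee_fin normal_pdfE ?gt_eqF //.
have /andP[pk _] := normal_peak_bounds s0.
have e2 : 2^-1 <= normal_fun 0 s x.
  have h : x ^+ 2 / (s ^+ 2 *+ 2) <= 2^-1.
    rewrite ler_pdivrMr ?mulrn_wgt0 ?exprn_gt0 //.
    have : x ^+ 2 <= s ^+ 2 by rewrite lerXn2r ?nnegrE ?(le_trans xt) // ltW.
    by rewrite -(mulr_natl (s ^+ 2) 2); lra.
  rewrite /normal_fun subr0 mulNr; apply: le_trans (expR_ge1Dx _); lra.
apply: le_trans (ler_pM _ _ pk e2); rewrite ?invr_ge0 ?mulr_ge0 ?(ltW s0) //.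
by rewrite -invfM lef_pV2 ?posrE ?mulr_gt0 //; lra.
Qed.

Lemma pr_normalN (s : R) (C : set R) : s != 0 -> measurable C ->
  pr (normal_prob 0 s) C = pr (normal_prob 0 s) [set z | C (- z)].
Proof. move=> s0 mC; congr fine; exact: normal_probN. Qed.

Lemma pr_normal_le0 (s : R) : s != 0 ->
  pr (normal_prob 0 s) [set x | x <= 0] = pr (normal_prob 0 s) [set x | 0 <= x].
Proof.
move=> s0; rewrite pr_normalN //; last exact: measurable_le.
by congr pr; apply/seteqP; split => x /=; rewrite oppr_le0.
Qed.

Lemma pr_normal_ge0 (s : R) : s != 0 -> 2^-1 <= pr (normal_prob 0 s) [set x | 0 <= x].
Proof.
move=> s0; have ml := measurable_le 0; have mg := measurable_ge 0.
have := @prU _ _ _ (normal_prob 0 s) _ _ ml mg; rewrite pr_normal_le0 //.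
rewrite (_ : _ `|` _ = setT) ?prT; first lra.
by rewrite -subTset => x _ /=; case: (leP x 0) => [|/ltW]; [left|right].
Qed.

Lemma pr_normal_gt0 (s : R) : s != 0 -> pr (normal_prob 0 s) [set x | 0 < x] <= 2^-1.
Proof.
move=> s0; have := pr_normal_ge0 s0; rewrite -pr_normal_le0 //.
rewrite (_ : [set x | 0 < x] = ~` [set x | x <= 0]); last first.
  by apply/seteqP; split => x /= => [h|/negP]; [apply/negP|]; rewrite -ltNge.
rewrite prC; [lra|exact: measurable_le].
Qed.

(** The density is compared with that of variance [2 s^2]: half of the exponent is at most
    [- (t / (2 s))^2] on the tail, the other half integrates to at most 1, and the ratio of the
    peaks is [sqrt 2 <= 2]. *)
Lemma pr_normal_tail (s t : R) : 0 < s -> 0 <= t ->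
  pr (normal_prob 0 s) [set x | t <= `|x|] <= 2 * expR (- (t / (2 * s)) ^+ 2).
Proof.
move=> s0 t0; have mI := measurable_norm_ge t.
pose c := 2 * expR (- (t / (2 * s)) ^+ 2).
have c0 : 0 <= c by rewrite mulr_ge0 ?expR_ge0.
pose s' := Num.sqrt 2 * s.
have q2 : 0 < Num.sqrt (2 : R) by rewrite sqrtr_gt0.
have s'0 : 0 < s' by rewrite mulr_gt0.
rewrite -lee_fin -prE //= /normal_prob.
apply: (@le_trans _ _ (\int[mu]_(x in [set x | (t <= `|x|)%R]) (c%:E * (normal_pdf 0 s' x)%:E))%E).
  apply: ge0_le_integral => //=.
  - by move=> x _; rewrite lee_fin normal_pdf_ge0.
  - exact: measurable_normal_pdfE.
  - by apply: measurable_funeM; exact: measurable_normal_pdfE.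
  move=> x /= tx; rewrite -EFinM lee_fin !normal_pdfE ?gt_eqF //.
  have -> : normal_peak s = Num.sqrt 2 * normal_peak s'.
    rewrite /normal_peak.
    have -> : s' ^+ 2 * pi *+ 2 = 2 * (s ^+ 2 * pi *+ 2).
      by rewrite /s' exprMn sqr_sqrtr // -mulrA -mulrnAr.
    rewrite (@sqrtrM _ 2 (s ^+ 2 * pi *+ 2)) //.
    by rewrite [in RHS]invfM mulrA divff ?gt_eqF // mul1r.
  have q22 : Num.sqrt 2 <= 2 :> R.
    have : Num.sqrt 2 ^+ 2 = 2 :> R by rewrite sqr_sqrtr.
    rewrite expr2; nra.
  rewrite -mulrA mulrCA [leRHS]mulrCA ler_wpM2l ?normal_peak_ge0 // /c -[leRHS]mulrA.
  apply: ler_pM => //; first exact: expR_ge0.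
  have s'2 : s' ^+ 2 *+ 2 = 4 * s ^+ 2.
    by rewrite /s' exprMn sqr_sqrtr // -mulr_natr; ring.
  rewrite /normal_fun !subr0 -expRD ler_expR s'2 -(mulr_natl (s ^+ 2) 2).
  rewrite expr_div_n exprMn.
  have s2 : 0 < s ^+ 2 by rewrite exprn_gt0.
  have xx : t ^+ 2 <= x ^+ 2 by rewrite -[x ^+ 2]real_normK ?num_real // lerXn2r ?nnegrE.
  have -> : - x ^+ 2 / (2 * s ^+ 2) = - (x ^+ 2 / s ^+ 2) / 2.
    by field; rewrite gt_eqF.
  have -> : - x ^+ 2 / (4 * s ^+ 2) = - (x ^+ 2 / s ^+ 2) / 4.
    by field; rewrite gt_eqF.
  have -> : t ^+ 2 / (2 ^+ 2 * s ^+ 2) = (t ^+ 2 / s ^+ 2) / 4.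
    by field; rewrite gt_eqF.
  have : t ^+ 2 / s ^+ 2 <= x ^+ 2 / s ^+ 2 by rewrite ler_pM2r // invr_gt0.
  lra.
rewrite ge0_integralZl //=; first last.
- by move=> x _; rewrite lee_fin normal_pdf_ge0.
- exact: measurable_normal_pdfE.
rewrite -[leRHS]mule1 lee_pmul2l ?lte_fin ?mulr_gt0 ?expR_gt0 //.
exact: (@probability_le1 _ _ _ (normal_prob 0 s') _ mI).
Qed.

End normal.

(** * The regression model *)

Section linear_forms.
Context {R : realType} (p1 p2 : nat).
Implicit Types U V : 'M[R]_(p1, p2).

Definition lin U (x : (p1 * p2).-tuple R) : R := minner U (mat_of x).

Lemma minnerE U V : minner U V = (mxvec U *m (mxvec V)^T) 0 0.
Proof.
rewrite mxvec_dot /minner /mxtrace; apply: eq_bigr => a _; rewrite mxE.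
by apply: eq_bigr => b _; rewrite mxE.
Qed.

Lemma minnerC U V : minner U V = minner V U.
Proof.
rewrite !minnerE !mxvec_dot; apply: eq_bigr => a _; apply: eq_bigr => b _.
by rewrite mulrC.
Qed.

Lemma linE U x : lin U x = dotv (vecc U) (col_of x).
Proof.
rewrite /lin minnerE /mat_of vec_mxK /dotv /vecc trmxK; congr ((_ *m _) 0 0).
by apply/colP => k; rewrite !mxE.
Qed.

Lemma linD U V x : lin (U + V) x = lin U x + lin V x.
Proof. by rewrite !linE /vecc !linearD /= dotvDl. Qed.

Lemma linB U V x : lin (U - V) x = lin U x - lin V x.
Proof. by rewrite !linE /vecc !linearB /= dotvBl. Qed.

Lemma linZ a U x : lin (a *: U) x = a * lin U x.
Proof. by rewrite !linE /vecc !linearZ /= dotvZl. Qed.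

Lemma measurable_dotv m (u : 'cV[R]_m) :
  measurable_fun setT (fun x : m.-tuple R => dotv u (col_of x)).
Proof.
rewrite (_ : (fun _ => _) = fun x : m.-tuple R => \sum_(k < m) u k 0 * tnth x k).
  apply: measurable_sum => k; apply: measurable_funM => //.
  exact: measurable_tnth.
by apply/funext => x; rewrite dotvE; apply: eq_bigr => k _; rewrite mxE.
Qed.

Lemma measurable_lin U : measurable_fun setT (lin U).
Proof.
rewrite (_ : lin U = fun x => dotv (vecc U) (col_of x)).
  exact: measurable_dotv.
by apply/funext => x; rewrite linE.
Qed.

End linear_forms.

Lemma measurable_preimage {d d'} {T : measurableType d} {T' : measurableType d'}
  (f : T -> T') (C : set T') : measurable_fun setT f -> measurable C -> measurable [set x | C (f x)].
Proof. by move=> mf mC; have := mf measurableT C mC; rewrite setTI. Qed.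

Section model.
Context {R : realType} (p1 p2 : nat) (sigma : R) (Sigma S : 'M[R]_(p1 * p2)).
Context (B : 'M[R]_(p1, p2)) (gamma : probability ((p1 * p2).-tuple R) R).
Context (PB : probability (@Obs R p1 p2) R).
Context (sigma0 : 0 < sigma).
Context (psdS : psd S).
Context (SS : S *m S = Sigma).
Context (gaussian : is_gaussian gamma Sigma).
Context (model : is_model PB gamma B sigma).

Local Notation noise := (normal_prob 0 sigma).

Definition shift_obs (w : (p1 * p2).-tuple R * R) : @Obs R p1 p2 := (w.1, w.2 + lin B w.1).

Lemma measurable_shift_obs : measurable_fun setT shift_obs.
Proof.
apply/measurable_fun_pairP; split; first exact: measurable_fst.
apply: measurable_funD; first exact: measurable_snd.
apply: measurableT_comp; first exact: measurable_lin.
exact: measurable_fst.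
Qed.

(** Under [PB] the residual is centred normal and independent of [X]: [PB] and the image of
    [gamma \x noise] under [shift_obs] agree on rectangles, which determine a finite measure. *)
Lemma PB_section (E : set (@Obs R p1 p2)) : measurable E ->
  PB E = (\int[gamma]_x noise [set z : R | E (x, (z + lin B x)%R)])%E.
Proof.
move=> mE; have mphi := measurable_shift_obs.
pose nu := pushforward (gamma \x noise)%E shift_obs.
pose C : set (set (@Obs R p1 p2)) := [set A1 `*` A2 | A1 in measurable & A2 in measurable].
transitivity (nu E); last first.
  rewrite /nu /pushforward /product_measure1 /=; apply: eq_integral => x _ /=.
  congr (normal_prob _ _ _); apply/seteqP; split => z /=; rewrite /xsection /= inE.
    by [].
  by [].
have s0 : sigma != 0 by rewrite gt_eqF.
apply: (measure_unique C (fun=> setT)) => //.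
- exact: measurable_prod_measurableType.
- move=> X Y [X1 mX1 [X2 mX2 <-{X}]] [Y1 mY1 [Y2 mY2 <-{Y}]].
  exists (X1 `&` Y1); first exact: measurableI.
  by exists (X2 `&` Y2); [exact: measurableI|rewrite setXI].
- by move=> n; exists setT => //; exists setT => //; rewrite setXTT.
- by rewrite bigcup_const //; exists 0%N.
- move=> _ [A mA [D mD <-]].
  have mB : measurable (shift_obs @^-1` (A `*` D)).
    by apply: measurable_preimage => //; exact: measurableX.
  rewrite [LHS](model mA mD) /nu /pushforward /product_measure1.
  rewrite integral_mkcond; apply: eq_integral => x _ /=.
  rewrite patchE; case: ifPn => xA.
    rewrite minnerC -/(lin B x) normal_prob_shift //; congr (normal_prob _ _ _).
    apply/seteqP; split => z /=; rewrite /xsection /= inE /shift_obs /=.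
      by move=> h; split => //=; rewrite inE in xA.
    by case.
  rewrite (_ : xsection _ _ = set0) ?measure0 // -subset0 => z.
  by rewrite /xsection /= inE => -[/= + _]; rewrite notin_setE in xA.
- by move=> n; rewrite -ge0_fin_numE // fin_num_measure.
Qed.

Lemma measurable_section (E : set (@Obs R p1 p2)) x : measurable E ->
  measurable [set z : R | E (x, z + lin B x)].
Proof.
move=> mE; apply: (@measurable_preimage _ _ _ _ (fun z : R => shift_obs (x, z)) E) => //.
apply: measurableT_comp; first exact: measurable_shift_obs.
exact/measurable_fun_pair/measurable_id/measurable_cst.
Qed.

Lemma pr_section_le (D : set ((p1 * p2).-tuple R)) (E : set (@Obs R p1 p2)) (c : R) :
  measurable D -> measurable E -> 0 <= c ->
  (forall x, D x -> pr noise [set z : R | E (x, z + lin B x)] <= c) ->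
  pr PB (E `&` [set w | D w.1]) <= c * pr gamma D.
Proof.
move=> mD mE c0 H.
have mDE : measurable (E `&` [set w : @Obs R p1 p2 | D w.1]).
  by apply: measurableI => //; apply: measurable_preimage => //; exact: measurable_fst.
rewrite -lee_fin EFinM -!prE // PB_section // -integral_cst //.
rewrite [leRHS]integral_mkcond; apply: ge0_le_integral => //.
- have /= := @measurable_fun_xsection _ _ _ _ R noise _
    (measurable_preimage measurable_shift_obs mDE).
  congr measurable_fun; apply/funext => x /=; congr (normal_prob _ _ _).
  by apply/seteqP; split => z; rewrite /xsection /= inE.
- by apply/(measurable_restrictT _ mD); exact: measurable_cst.
move=> x _; rewrite patchE; case: ifPn => xD.
  rewrite /= inE in xD; rewrite -[leRHS]/(c%:E).
  have mS := measurable_section x mE.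
  have := H x xD; rewrite -lee_fin -prE //; apply: le_trans.
  by apply: le_measure; rewrite ?inE //; [exact: measurable_section|move=> z []].
rewrite notin_setE in xD; rewrite (_ : [set z : R | _] = set0) ?measure0 //.
by rewrite -subset0 => z [].
Qed.

Lemma pr_section_ge (E : set (@Obs R p1 p2)) (c : R) : measurable E ->
  (forall x, c <= pr noise [set z : R | E (x, z + lin B x)]) -> c <= pr PB E.
Proof.
move=> mE H.
have mEc := measurableC mE.
have mT : measurable (@setT ((p1 * p2).-tuple R)) by [].
have [c1|c1] := leP c 1; last first.
  by have := H [tuple 0 | _ < _]; have := pr_le1 noise (measurable_section [tuple 0 | _ < _] mE); lra.
have := @pr_section_le setT (~` E) (1 - c) mT mEc; rewrite subr_ge0 => /(_ c1).
rewrite prT setIT prC // => h.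
suff : 1 - pr PB E <= (1 - c) * 1 by lra.
apply: h => x _; have -> : [set z : R | (~` E) (x, z + lin B x)] = ~` [set z : R | E (x, z + lin B x)] by [].
by rewrite prC ?lerB //; exact: measurable_section.
Qed.

Section marginals.
Context (u : 'cV[R]_(p1 * p2)).

Lemma measurable_dotv_preimage (C : set R) : measurable C ->
  measurable [set x : (p1 * p2).-tuple R | C (dotv u (col_of x))].
Proof. by move=> mC; apply: measurable_preimage => //; exact: measurable_dotv. Qed.

Lemma marginal_law (C : set R) : measurable C ->
  gamma [set x | C (dotv u (col_of x))] = normal_law 0 (enorm (S *m u) ^+ 2) C.
Proof.
move=> mC; rewrite [LHS](gaussian u mC).
have [St _] := psdS.
by rewrite sqr_enorm /dotv trmx_mul St -SS !mulmxA.
Qed.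

Lemma marginal_pr (C : set R) : enorm (S *m u) != 0 -> measurable C ->
  pr gamma [set x | C (dotv u (col_of x))] = pr (normal_prob 0 (enorm (S *m u))) C.
Proof.
move=> e0 mC; congr fine; rewrite marginal_law // /normal_law expf_eq0 /= (negbTE e0).
by rewrite sqrtr_sqr ger0_norm ?enorm_ge0.
Qed.

Lemma marginal_null (C : set R) : enorm (S *m u) = 0 -> measurable C -> ~ C 0 ->
  pr gamma [set x | C (dotv u (col_of x))] = 0.
Proof.
move=> e0 mC C0; rewrite /pr marginal_law // /normal_law e0 expr0n eqxx /=.
by rewrite indicE memNset.
Qed.

Lemma marginal_tail (s t : R) : enorm (S *m u) <= s -> 0 < s -> 0 < t ->
  pr gamma [set x | t <= `|dotv u (col_of x)|] <= 2 * expR (- (t / (2 * s)) ^+ 2).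
Proof.
move=> es s0 t0; have mC := measurable_norm_ge t.
have [e0|e0] := eqVneq (enorm (S *m u)) 0.
  rewrite (@marginal_null [set x | t <= `|x|]) ?mulr_ge0 ?expR_ge0 //=.
  by rewrite normr0 leNgt t0.
have ep : 0 < enorm (S *m u) by rewrite lt0r e0 enorm_ge0.
rewrite (@marginal_pr [set x | t <= `|x|]) //.
apply: le_trans (pr_normal_tail ep (ltW t0)) _.
rewrite ler_pM2l // ler_expR lerN2 lerXn2r ?nnegrE ?divr_ge0 ?mulr_ge0 ?(ltW t0) ?(ltW s0) ?(ltW ep) //.
by rewrite ler_pM2l // lef_pV2 ?posrE ?mulr_gt0 // ler_pM2l.
Qed.

Lemma marginal_small (a : R) : enorm (S *m u) = 1 -> 0 <= a ->
  pr gamma [set x | `|dotv u (col_of x)| <= a] <= a.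
Proof.
move=> e1 a0.
rewrite (_ : [set x | _] = [set x | [set z | - a <= z <= a] (dotv u (col_of x))]); last first.
  by apply/seteqP; split => x /=; rewrite ler_norml.
rewrite marginal_pr ?e1 ?oner_eq0 //; last exact: measurable_between.
apply: le_trans (@pr_normal_between_le R 0 1 (- a) a _ _) _ => //; first lra.
rewrite mulr1; lra.
Qed.

End marginals.

(* [range S] carries [gamma]; on it [x = S w] and [lin U x] is controlled by [S (vec U)],
   uniformly in [U]. *)
Lemma bounded_region (delta : R) : 0 < delta ->
  exists (D : set ((p1 * p2).-tuple R)) (rho : R),
    [/\ measurable D, 0 < rho, pr gamma (~` D) <= delta &
      forall x, D x -> forall U, `|lin U x| <= rho * enorm (S *m vecc U)].
Proof.
move=> d0; set N := (p1 * p2)%N; have [St _] := psdS.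
(* [S] kills each [a i], so these forms vanish almost surely, which places [x] in the range of [S];
   the [b i] read off the coordinates of a preimage [w]. *)
pose a (i : 'I_N) : 'cV[R]_N := (row i (1%:M - S *m pinvmx S))^T.
pose b (i : 'I_N) : 'cV[R]_N := (row i (pinvmx S))^T.
pose s := 1 + \sum_i enorm (S *m b i).
have s0 : 0 < s by rewrite ltr_pwDl // sumr_ge0 // => i _; exact: enorm_ge0.
(* Since [exp(- y^2) <= 1 / y], the [N] tails add up to at most [2 N / y <= delta]. *)
pose y := 2 * N%:R / delta + 1.
have y1 : 1 <= y by rewrite lerDr divr_ge0 ?mulr_ge0 // ltW.
pose t := 2 * s * y.
have t0 : 0 < t by rewrite !mulr_gt0 //; lra.
pose A i := [set x : N.-tuple R | dotv (a i) (col_of x) != 0].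
pose C i := [set x : N.-tuple R | t <= `|dotv (b i) (col_of x)|].
have mne : measurable [set z : R | z != 0].
  rewrite (_ : [set _ | _] = ~` [set 0]); first exact: measurableC (measurable_set1 0).
  by apply/seteqP; split => z /= /eqP.
have mA i : measurable (A i) by exact: (measurable_dotv_preimage (a i) mne).
have mC i : measurable (C i) by exact: (measurable_dotv_preimage (b i) (measurable_norm_ge t)).
have A0 i : pr gamma (A i) = 0.
  apply: (@marginal_null (a i) [set z : R | z != 0]) => //=; last by rewrite eqxx.
  have -> : S *m a i = 0.
    rewrite /a -[S *m _]trmxK trmx_mul trmxK St -row_mul mulmxBl mul1mx -mulmxA.
    by rewrite mulmxA mulmxKpV // subrr row0 trmx0.
  by rewrite /enorm big1 ?sqrtr0 // => k _; rewrite mxE expr0n.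
have Ct i : pr gamma (C i) <= y^-1 * 2.
  apply: le_trans (marginal_tail (s := s) _ s0 t0) _.
    rewrite /s (bigD1 i) //= addrCA lerDl addr_ge0 // sumr_ge0 // => k _.
    exact: enorm_ge0.
  rewrite mulrC ler_pM2r // expRN lef_pV2 ?posrE ?expR_gt0 //; last by lra.
  have -> : t / (2 * s) = y by rewrite /t; field; rewrite gt_eqF.
  apply: le_trans (expR_ge1Dx _); rewrite expr2; nra.
have [mUA leUA] := @pr_union_seq _ _ _ gamma _ (enum 'I_N) A (fun i _ => mA i).
have [mUC leUC] := @pr_union_seq _ _ _ gamma _ (enum 'I_N) C (fun i _ => mC i).
set UA := [set x | _] in mUA leUA; set UC := [set x | _] in mUC leUC.
exists (~` (UA `|` UC)), (Num.sqrt (\sum_(k < N) t ^+ 2) + 1); split.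
- exact/measurableC/measurableU.
- by rewrite ltr_wpDl // sqrtr_ge0.
- rewrite setCK; apply: le_trans (prU _ mUA mUC) _.
  apply: le_trans (lerD leUA leUC) _.
  rewrite big1 => [|i _]; last exact: A0.
  rewrite add0r; apply: (@le_trans _ _ (\sum_(i <- enum 'I_N) y^-1 * 2)).
    by apply: ler_sum => i _; exact: Ct.
  rewrite big_enum /= sumr_const card_ord -(mulr_natl _ N).
  have -> : N%:R * (y^-1 * 2) = (2 * N%:R) / y by ring.
  rewrite ler_pdivrMr; last by lra.
  by rewrite /y mulrDr mulr1 [delta * _]mulrC divfK ?gt_eqF // lerDl ltW.
move=> x /not_orP[nA nC] U.
set w := pinvmx S *m col_of x.
have xE : col_of x = S *m w.
  apply/eqP; rewrite -subr_eq0; apply/eqP/colP => i; rewrite [RHS]mxE.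
  apply/eqP/negPn/negP => h; apply: nA; exists i; first by rewrite mem_enum.
  rewrite /A /= /a /dotv trmxK -row_mul mxE mulmxBl mul1mx -mulmxA.
  exact: h.
have wt : enorm w <= Num.sqrt (\sum_(k < N) t ^+ 2).
  rewrite /enorm ler_wsqrtr // ler_sum // => k _.
  have : `|dotv (b k) (col_of x)| < t.
    rewrite ltNge; apply/negP => h; apply: nC; exists k => //; by rewrite mem_enum.
  have -> : dotv (b k) (col_of x) = w k 0 by rewrite /dotv /b trmxK -row_mul mxE.
  by move=> h; rewrite -[_ ^+ 2]real_normK ?num_real // lerXn2r ?nnegrE // ltW.
rewrite linE xE /dotv mulmxA -{1}St -trmx_mul -/(dotv _ _).
apply: le_trans (dotv_le _ _) _; rewrite mulrC ler_wpM2r ?enorm_ge0 //; lra.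
Qed.

Definition residual (b : R) U (w : @Obs R p1 p2) : R := w.2 - lin B w.1 - b * lin U w.1.

(** The event counted by the depth of [B + b U] along [U], as [residual b U] is the residual of that
    matrix. *)
Definition dset b U : set (@Obs R p1 p2) := [set w | 0 <= lin U w.1 * residual b U w].

(** A neighbourhood of the two zero sets that bound [dset b V]: moving [lin] by [a] moves the
    residual by [b * a], hence the two widths. *)
Definition bad b V a : set (@Obs R p1 p2) :=
  [set w | `|lin V w.1| <= a] `|` [set w | `|residual b V w| <= b * a].

Definition far W t : set (@Obs R p1 p2) := [set w | t <= `|lin W w.1|].

Lemma measurable_lin_fst U : measurable_fun setT (fun w : @Obs R p1 p2 => lin U w.1).
Proof. by apply: measurableT_comp; [exact: measurable_lin|exact: measurable_fst]. Qed.

Lemma measurable_residual b U : measurable_fun setT (residual b U).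
Proof.
apply: measurable_funB.
  by apply: measurable_funB; [exact: measurable_snd|exact: measurable_lin_fst].
by apply: measurable_funM => //; exact: measurable_lin_fst.
Qed.

Lemma measurable_dset b U : measurable (dset b U).
Proof.
apply: (@measurable_preimage _ _ _ _ (fun w : @Obs R p1 p2 => lin U w.1 * residual b U w) [set z | 0 <= z]).
  by apply: measurable_funM; [exact: measurable_lin_fst|exact: measurable_residual].
exact: measurable_ge.
Qed.

Lemma measurable_norm_le (a : R) : measurable [set z : R | `|z| <= a].
Proof.
rewrite (_ : [set _ | _] = [set z | - a <= z <= a]); first exact: measurable_between.
by apply/seteqP; split => z /=; rewrite ler_norml.
Qed.

Lemma measurable_bad b V a : measurable (bad b V a).
Proof.
apply: measurableU.
  apply: (@measurable_preimage _ _ _ _ (fun w : @Obs R p1 p2 => lin V w.1) [set z | `|z| <= a]);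
  [exact: measurable_lin_fst|exact: measurable_norm_le].
apply: (@measurable_preimage _ _ _ _ (residual b V) [set z | `|z| <= b * a]);
[exact: measurable_residual|exact: measurable_norm_le].
Qed.

Lemma measurable_far W t : measurable (far W t).
Proof.
apply: (@measurable_preimage _ _ _ _ (fun w : @Obs R p1 p2 => lin W w.1) [set z | t <= `|z|]);
[exact: measurable_lin_fst|exact: measurable_norm_ge].
Qed.

(* Off [bad b V a] and [far (U - V) a], the signs of [lin] and of [residual] are those of [V]. *)
Lemma dset_close b U V a w : 0 <= b -> ~ bad b V a w -> ~ far (U - V) a w ->
  dset b U w <-> dset b V w.
Proof.
move=> b0 /not_orP[/negP h1 /negP h2] /negP; rewrite -!ltNge in h1 h2 * => h3.
rewrite /dset /= /residual; rewrite /residual in h2.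
set z := w.2 - lin B w.1 in h2 *.
have e : lin (U - V) w.1 = lin U w.1 - lin V w.1 by rewrite linB.
rewrite e in h3; set u := lin U w.1 in h3 *; set v := lin V w.1 in h1 h2 h3 *.
move: h3; rewrite ltr_norml => /andP[h3 h4].
have b1 : b * (u - v) <= b * a by rewrite ler_wpM2l // ltW.
have b2 : b * (- a) <= b * (u - v) by rewrite ler_wpM2l // ltW.
move: h1 h2; rewrite !lter_normr.
have pos x y : 0 < x -> 0 < y -> 0 <= x * y by move=> x0 y0; rewrite mulr_ge0 // ltW.
have neg x y : x < 0 -> y < 0 -> 0 <= x * y by move=> x0 y0; rewrite mulr_le0 // ltW.
have pn x y : 0 < x -> y < 0 -> ~ 0 <= x * y.
  by move=> x0 y0 /(lt_le_trans (_ : x * y < 0)); rewrite pmulr_rlt0 // ltxx => /(_ y0).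
have np x y : x < 0 -> 0 < y -> ~ 0 <= x * y by move=> x0 y0; rewrite mulrC; exact: pn.
move=> /orP[v0|v0] /orP[r0|r0].
- by split => _; apply: pos; lra.
- by split => h; [have []: ~ 0 <= u * (z - b * u)|have []: ~ 0 <= v * (z - b * v)] => //;
    apply: pn; lra.
- by split => h; [have []: ~ 0 <= u * (z - b * u)|have []: ~ 0 <= v * (z - b * v)] => //;
    apply: np; lra.
- by split => _; apply: neg; lra.
Qed.

Lemma pr_dset_ge U : 2^-1 <= pr PB (dset 0 U).
Proof.
have s0 : sigma != 0 by rewrite gt_eqF.
have mD := measurable_dset 0 U.
apply: pr_section_ge => // x; have mS := measurable_section x mD.
have [u0|u0] := leP 0 (lin U x).
  apply: le_trans (pr_normal_ge0 s0) _; apply: pr_le => //; first exact: measurable_ge.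
  by move=> z /= z0; rewrite /dset /residual /= addrK mul0r subr0 mulr_ge0.
apply: (@le_trans _ _ (pr noise [set z | z <= 0])).
  by rewrite pr_normal_le0 //; exact: pr_normal_ge0.
apply: pr_le => //; first exact: measurable_le.
move=> z /= z0; rewrite /dset /residual /= addrK mul0r subr0 mulr_le0 //; exact: ltW.
Qed.

Lemma pr_noise_ge0 : pr noise [set z | 0 <= z] <= 2^-1.
Proof.
have s0 : sigma != 0 by rewrite gt_eqF.
have m1 := measurable_gt (0 : R); have m2 := measurable_between (0 : R) 0.
have -> : [set z : R | 0 <= z] = [set z | 0 < z] `|` [set z | 0 <= z <= 0].
  apply/seteqP; split => z /=; last by move=> [/ltW|/andP[]].
  move=> z0; have [->|zn] := eqVneq z 0; first by right; rewrite lexx.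
  by left; rewrite lt_neqAle eq_sym zn.
have := @prU _ _ _ noise _ _ m1 m2.
have := pr_normal_gt0 s0; have := pr_normal_between_le 0 sigma0 (lexx (0 : R)).
rewrite subrr mul0r; lra.
Qed.

Lemma pr_noise_gap t : 0 < t <= sigma -> pr noise [set z | 2 * t <= z] <= 2^-1 - t / (6 * sigma).
Proof.
move=> /andP[t0 ts].
have m1 := measurable_ge (2 * t); have m2 := measurable_between 0 t; have m0 := measurable_ge (0 : R).
have := @pr_normal_between_ge R sigma t; rewrite (ltW t0) ts => /(_ isT sigma0).
have := prDI noise m0 m1.
have -> : [set z : R | 0 <= z] `&` [set z | 2 * t <= z] = [set z | 2 * t <= z].
  apply/seteqP; split => z /=; first by case.
  move=> h; split => //; lra.
have : pr noise [set z | 0 <= z <= t] <= pr noise ([set z : R | 0 <= z] `\` [set z | 2 * t <= z]).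
  apply: pr_le => //; first exact: measurableD.
  by move=> z /= /andP[z0 zt]; split => //; apply/negP; rewrite -ltNge; lra.
have := pr_noise_ge0; lra.
Qed.

(** Given [v = <U,X>], the event is a half-line of the noise cut at [b v], away from 0 on the side
    of its mass, so it has probability at most 1/2. When [|v| >= 1/4], which has probability at
    least 3/4, the cut is beyond [2 (b / 8)] and [pr_noise_gap] saves [b / (48 sigma)];
    [3/4 * 1/48 = 1/64]. *)
Lemma pr_dset_le b U : 0 <= b <= sigma -> enorm (S *m vecc U) = 1 ->
  pr PB (dset b U) <= 2^-1 - b / (64 * sigma).
Proof.
move=> /andP[b0 bs] U1; have s0 : sigma != 0 by rewrite gt_eqF.
have mD := measurable_dset b U; have mg := measurable_ge (0 : R); have ml := measurable_le (0 : R).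
pose v x := dotv (vecc U) (col_of x).
pose D1 := [set x : (p1 * p2).-tuple R | 4^-1 <= `|v x|].
pose D2 := [set x : (p1 * p2).-tuple R | 0 < `|v x| < 4^-1].
pose D3 := [set x : (p1 * p2).-tuple R | v x = 0].
have m1 : measurable D1 by exact: (measurable_dotv_preimage (vecc U) (measurable_norm_ge _)).
have m3 : measurable D3 by exact: (measurable_dotv_preimage (vecc U) (measurable_set1 0)).
have m2 : measurable D2.
  have -> : D2 = ~` (D1 `|` D3).
    apply/seteqP; split => x; rewrite /D1 /D2 /D3 /= normr_gt0.
      by move=> /andP[/eqP v0 v4] [|//]; rewrite leNgt v4.
    by move=> /not_orP[/negP v4 /eqP v0]; rewrite v0 ltNge.
  exact/measurableC/measurableU.
have sec x z : dset b U (x, z + lin B x) = (0 <= v x * (z - b * v x)) :> Prop.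
  by rewrite /dset /residual /= addrK linE.
have mS x := measurable_section x mD.
have c0 : 0 <= b / (48 * sigma) by rewrite divr_ge0 // mulr_ge0 // ltW.
have c1 : b / (48 * sigma) <= 2^-1.
  by rewrite ler_pdivrMr ?mulr_gt0 //; lra.
have neg C : measurable C -> pr noise C = pr noise [set z | C (- z)].
  by move=> mC; exact: pr_normalN.
have le_half x : v x != 0 -> pr noise [set z | dset b U (x, z + lin B x)] <= 2^-1.
  move=> vx; case: (ltgtP (v x) 0) vx => // vx _; last first.
    apply: le_trans pr_noise_ge0; apply: (@pr_le _ _ _ noise _ _ (mS x) mg) => z.
    rewrite /= sec pmulr_rge0 // subr_ge0.
    by apply: le_trans; rewrite mulr_ge0 // ltW.
  rewrite neg; last exact: mS.
  have mN : measurable_fun setT (-%R : R -> R) by [].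
  apply: le_trans pr_noise_ge0; apply: (@pr_le _ _ _ noise _ _ (measurable_preimage mN (mS x)) mg).
  move=> z; rewrite /= sec nmulr_rge0 // subr_le0 => h.
  have : b * v x <= 0 by rewrite mulr_ge0_le0 // ltW.
  lra.
have e1 : pr PB (dset b U `&` [set w | D1 w.1]) <= (2^-1 - b / (48 * sigma)) * pr gamma D1.
  apply: pr_section_le => //; first by rewrite subr_ge0.
  move=> x xD; have vx : v x != 0 by rewrite -normr_gt0; apply: lt_le_trans xD; lra.
  have [bz|bn0] := eqVneq b 0.
    by move: (le_half x vx); rewrite bz mul0r subr0.
  have b8 : 0 < b / 8 <= sigma by rewrite divr_gt0 ?lt0r ?bn0 //=; lra.
  have gap : pr noise [set z | 2 * (b / 8) <= z] <= 2^-1 - b / (48 * sigma).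
    apply: le_trans (pr_noise_gap b8) _; rewrite lerD2l lerN2 -mulrA -invfM mulrA.
    by rewrite (_ : 8 * 6 = 48) //; lra.
  move: xD; rewrite /D1 /= lter_normr => /orP[xD|xD].
    apply: le_trans gap; apply: (@pr_le _ _ _ noise _ _ (mS x) (measurable_ge _)) => z.
    rewrite /= sec pmulr_rge0; last lra.
    by have := ler_wpM2l b0 xD; rewrite subr_ge0; lra.
  rewrite neg; last exact: mS.
  have mN : measurable_fun setT (-%R : R -> R) by [].
  apply: le_trans gap.
  apply: (@pr_le _ _ _ noise _ _ (measurable_preimage mN (mS x)) (measurable_ge _)) => z.
  rewrite /= sec nmulr_rge0; last lra.
  by have := ler_wpM2l b0 xD; rewrite subr_le0; lra.
have e2 : pr PB (dset b U `&` [set w | D2 w.1]) <= 2^-1 * pr gamma D2.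
  apply: pr_section_le => // x /andP[x0 _]; apply: le_half; by rewrite -normr_gt0.
have e3 : pr PB (dset b U `&` [set w | D3 w.1]) <= 1 * pr gamma D3.
  by apply: pr_section_le => // x _; exact: (@pr_le1 _ _ _ noise _ (mS x)).
have d3 : pr gamma D3 = 0.
  rewrite (marginal_pr (u := vecc U) _ (measurable_set1 0)) ?U1 ?oner_eq0 //.
  apply/eqP; rewrite eq_le pr_ge0 andbT.
  have := @pr_normal_between_le R 0 1 0 0 ltr01 (lexx 0); rewrite subrr mul0r.
  by congr (pr _ _ <= _); apply/seteqP; split => z /=; rewrite -eq_le eq_sym => /eqP.
have d1 : 3 / 4 <= pr gamma D1.
  have mC : measurable [set x : (p1 * p2).-tuple R | `|v x| <= 4^-1].
    exact: (measurable_dotv_preimage (vecc U) (measurable_norm_le 4^-1)).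
  have small : pr gamma [set x | `|v x| <= 4^-1] <= 4^-1 by apply: marginal_small => //; lra.
  have : pr gamma (~` D1) <= 4^-1.
    apply: le_trans small; apply: pr_le => //; first exact: measurableC.
    by move=> x /negP; rewrite -ltNge => /ltW.
  by rewrite prC //; lra.
have d12 : pr gamma D1 + pr gamma D2 <= 1.
  have : pr gamma D2 <= pr gamma (~` D1).
    apply: pr_le => //; first exact: measurableC.
    by move=> x /andP[_ x4] h; move: x4; rewrite ltNge; move/negP; apply; exact: h.
  by rewrite prC //; lra.
have mE D : measurable D -> measurable (dset b U `&` [set w : @Obs R p1 p2 | D w.1]).
  by move=> mD'; apply: measurableI => //; apply: measurable_preimage => //; exact: measurable_fst.
have cover : pr PB (dset b U) <= pr PB (dset b U `&` [set w | D1 w.1]) +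
    pr PB (dset b U `&` [set w | D2 w.1]) + pr PB (dset b U `&` [set w | D3 w.1]).
  apply: (@le_trans _ _ (pr PB ((dset b U `&` [set w | D1 w.1]) `|`
    (dset b U `&` [set w | D2 w.1]) `|` (dset b U `&` [set w | D3 w.1])))).
    apply: pr_le => //; first by apply: measurableU; [apply: measurableU|]; exact: mE.
    move=> w dw; rewrite /D1 /D2 /D3 /= normr_gt0.
    have [v0|v0] := eqVneq (v w.1) 0; first by right.
    by left; case: (leP 4^-1 `|v w.1|) => h; [left|right].
  apply: le_trans (prU _ (measurableU _ _ (mE _ m1) (mE _ m2)) (mE _ m3)) _.
  by rewrite lerD2r; apply: prU; exact: mE.
rewrite d3 in e3.
have h : (3 / 4) * (b / (48 * sigma)) <= pr gamma D1 * (b / (48 * sigma)) by rewrite ler_wpM2r.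
have -> : b / (64 * sigma) = (3 / 4) * (b / (48 * sigma)) by field.
lra.
Qed.

(** Each half costs [a]: [lin V] is standard normal with density at most 1/2, and given [X] the
    residual lies in an interval of length [2 b a] under a density at most [1 / (2 sigma)], with
    [b <= sigma]. *)
Lemma pr_bad_le b V a : 0 <= b <= sigma -> 0 <= a -> enorm (S *m vecc V) = 1 ->
  pr PB (bad b V a) <= 2 * a.
Proof.
move=> /andP[b0 bs] a0 V1.
have mT : measurable (@setT ((p1 * p2).-tuple R)) by [].
have m1 : measurable [set w : @Obs R p1 p2 | `|lin V w.1| <= a].
  apply: (@measurable_preimage _ _ _ _ (fun w : @Obs R p1 p2 => lin V w.1) [set z | `|z| <= a]);
  [exact: measurable_lin_fst|exact: measurable_norm_le].
have m2 : measurable [set w : @Obs R p1 p2 | `|residual b V w| <= b * a].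
  apply: (@measurable_preimage _ _ _ _ (residual b V) [set z | `|z| <= b * a]);
  [exact: measurable_residual|exact: measurable_norm_le].
have mC : measurable [set x : (p1 * p2).-tuple R | `|dotv (vecc V) (col_of x)| <= a].
  exact: (measurable_dotv_preimage (vecc V) (measurable_norm_le a)).
apply: le_trans (prU _ m1 m2) _.
have -> : 2 * a = 1 * a + a * 1 by ring.
apply: lerD.
  have -> : [set w : @Obs R p1 p2 | `|lin V w.1| <= a] =
     setT `&` [set w | `|dotv (vecc V) (col_of w.1)| <= a].
    by rewrite setTI; apply/seteqP; split => w /=; rewrite linE.
  apply: le_trans (pr_section_le mC measurableT ler01 _) _.
    by move=> x _; apply: (@pr_le1 _ _ _ noise); exact: measurable_section.
  by rewrite ler_wpM2l //; exact: marginal_small.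
rewrite -(prT gamma) -[X in pr PB X]setIT.
apply: (@pr_section_le setT) => // x _.
have -> : [set z : R | [set w | `|residual b V w| <= b * a] (x, z + lin B x)] =
    [set z | b * lin V x - b * a <= z <= b * lin V x + b * a].
  apply/seteqP; split => z; rewrite /= /residual /= addrK ler_norml => /andP[h1 h2];
    apply/andP; split; lra.
have ba : 0 <= b * a by rewrite mulr_ge0.
apply: le_trans (pr_normal_between_le 0 sigma0 _) _; first lra.
rewrite ler_pdivrMr ?mulr_gt0 //.
have : b * a <= sigma * a by rewrite ler_wpM2r.
lra.
Qed.

Lemma pr_far_le W s t : enorm (S *m vecc W) <= s -> 0 < s -> 0 < t ->
  pr PB (far W t) <= 2 * expR (- (t / (2 * s)) ^+ 2).
Proof.
move=> Ws s0 t0.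
have mC : measurable [set x : (p1 * p2).-tuple R | t <= `|dotv (vecc W) (col_of x)|].
  exact: (measurable_dotv_preimage (vecc W) (measurable_norm_ge t)).
have -> : far W t = setT `&` [set w | t <= `|dotv (vecc W) (col_of w.1)|].
  by rewrite setTI; apply/seteqP; split => w /=; rewrite /far /= linE.
apply: le_trans (pr_section_le mC measurableT ler01 _) _.
  by move=> x _; apply: (@pr_le1 _ _ _ noise); exact: measurable_section.
by rewrite mul1r; exact: marginal_tail.
Qed.

End model.

(** * Exponential deviation bounds for empirical counts *)

Lemma expR_le_quad {R : realType} (x : R) : x <= 2^-1 -> expR x <= 1 + x + 2 * x ^+ 2.
Proof.
(* [exp x <= 1 / (1 - x)], and [(1 - x) (1 + x + 2 x^2) = 1 + x^2 (1 - 2 x) >= 1]. *)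
move=> x2; rewrite -[x in expR x]opprK expRN invf_ple ?posrE ?expR_gt0 //; last first.
  have := sqr_ge0 (x + 4^-1); rewrite !expr2; lra.
apply: le_trans (expR_ge1Dx _).
rewrite invf_ple ?posrE; [|by have := sqr_ge0 (x + 4^-1); rewrite !expr2; lra|by lra].
rewrite -[leLHS]mul1r ler_pdivrMr; last by lra.
have : 0 <= x ^+ 2 * (1 - 2 * x) by rewrite mulr_ge0 ?sqr_ge0 //; lra.
rewrite !expr2; lra.
Qed.

Section deviations.
Context {R : realType} {d : measure_display} {T : measurableType d} (n : nat).
Context (Prob : probability (n.-tuple T) R) (mu : probability T R).
Context (hiid : iid Prob mu).

Definition cnt (A : set T) (s : n.-tuple T) : R := \sum_i \1_A (tnth s i).

Definition dev (A : set T) (s : n.-tuple T) : R := cnt A s - n%:R * pr mu A.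

Lemma cnt_le A A' s : A `<=` A' -> cnt A s <= cnt A' s.
Proof.
move=> AA; apply: ler_sum => i _; rewrite !indicE ler_nat.
by have [/set_mem/AA/mem_set ->|//] := boolP (tnth s i \in A).
Qed.

(** The two indicators differ only on the symmetric difference, so [v] acts as the variance. [lam]
    stays free, to be tuned at each level of the chain; an empty set in one slot gives a single
    count. *)
Lemma bernstein (A A' : set T) (lam v y : R) :
  measurable A -> measurable A' -> 0 < lam <= 2^-1 ->
  pr mu (A `\` A') + pr mu (A' `\` A) <= v ->
  small Prob (expR (- y)) [set s | 2 * n%:R * lam * v + y / lam <= dev A s - dev A' s].
Proof.
move=> mA mA' /andP[l0 l1] hv.
pose l x : bool * bool := (x \in A, x \in A').
pose wt (ab : bool * bool) : R := lam * (ab.1%:R - ab.2%:R).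
pose X (b : bool) (A : set T) := if b then A else ~` A.
have lE a b : l @^-1` [set (a, b)] = X a A `&` X b A'.
  apply/seteqP; split => x; rewrite /l /X /=.
    by move=> [<- <-]; split; case: ifPn; rewrite ?inE ?notin_setE.
  move=> [h1 h2]; congr (_, _).
    by case: a h1 => h; [exact: mem_set|exact: memNset].
  by case: b h2 => h; [exact: mem_set|exact: memNset].
have mX b C : measurable C -> measurable (X b C).
  by move=> mC; case: b => //; exact: measurableC.
have ml ab : measurable (l @^-1` [set ab]).
  by case: ab => a b; rewrite lE; apply: measurableI; exact: mX.
pose u := lam * (n%:R * (pr mu A - pr mu A')) + 2 * n%:R * lam ^+ 2 * v + y.
have [mE leE] := chernoff_label hiid wt u ml.
apply: (@small_sub _ _ _ _ _ _ _ _ _ (lexx _) (small_measurable mE _)).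
  move=> s /= h; rewrite /u.
  have -> : \sum_i wt (l (tnth s i)) = lam * (cnt A s - cnt A' s).
    rewrite /cnt -sumrB mulr_sumr; apply: eq_bigr => i _.
    by rewrite /wt /l !indicE.
  have := ler_wpM2l (ltW l0) h; rewrite /dev mulrDr (mulrC lam (y / lam)) divfK ?gt_eqF //.
  rewrite expr2; lra.
apply: le_trans leE _.
set M := \sum_v _.
have M0 : 0 <= M by apply: sumr_ge0 => ab _; rewrite mulr_ge0 ?expR_ge0 ?pr_ge0.
have Mle : M <= expR (lam * (pr mu A - pr mu A') + 2 * lam ^+ 2 * v).
  apply: le_trans (expR_ge1Dx _).
  have -> : M = \sum_(a : bool) \sum_(b : bool) expR (wt (a, b)) * pr mu (l @^-1` [set (a, b)]).
    by rewrite pair_bigA; apply: eq_bigr => -[a b].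
  rewrite !big_bool /= !lE /X /wt /= !subrr mulr0 expR0 !mul1r subr0 mulr1 sub0r mulrN1.
  have q1 := expR_le_quad l1.
  have q2 : expR (- lam) <= 1 + - lam + 2 * (- lam) ^+ 2 by apply: expR_le_quad; lra.
  rewrite sqrrN in q2.
  have mCA := measurableC mA; have mCA' := measurableC mA'.
  have e1 := prDI mu mA mA'; have e2 := prDI mu mA' mA.
  have e3 := prDI mu mCA mA'.
  have e4 := prC mu mA.
  rewrite !setDE [A' `&` A]setIC [A' `&` ~` A]setIC in e1 e2 e3 hv.
  have e5 : lam * (pr mu A - pr mu A') = lam * (pr mu (A `&` ~` A') - pr mu (~` A `&` A')).
    by rewrite e1 e2; ring.
  rewrite e5; have := ler_wpM2r (pr_ge0 mu (A `&` ~` A')) q1.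
  have := ler_wpM2r (pr_ge0 mu (~` A `&` A')) q2.
  have := ler_wpM2l (sqr_ge0 lam) hv.
  rewrite !expr2; lra.
have : M ^+ n <= expR (n%:R * (lam * (pr mu A - pr mu A') + 2 * lam ^+ 2 * v)).
  by rewrite mulrC expRM_natr lerXn2r ?nnegrE ?expR_ge0.
move=> /(ler_wpM2l (expR_ge0 (- u))) h; apply: le_trans h _.
rewrite -expRD ler_expR /u; lra.
Qed.

Lemma count_deviation (A : set T) (v y : R) :
  measurable A -> pr mu A <= v ->
  small Prob (expR (- y)) [set s | 2 * n%:R * v + 2 * y <= cnt A s].
Proof.
move=> mA Av.
have h : 0 < (2^-1 : R) <= 2^-1 by lra.
have := @bernstein A set0 2^-1 v y mA measurable0 h.
rewrite setD0 set0D pr0 addr0 => /(_ Av); apply: small_sub => // s /=.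
have -> : dev set0 s = 0.
  by rewrite /dev /cnt big1 ?pr0 ?mulr0 ?subr0 // => i _; rewrite indicE in_set0.
have := ler_wpM2l (ler0n R n) Av; rewrite /dev invrK; lra.
Qed.

(** Unlike in [bernstein], [lam] may be large. This exploits events much rarer than [exp(- lam)], as
    the [far] sets beneath the scale [tau] are. *)
Lemma count_tail (A : set T) (lam m p : R) : 0 <= lam ->
  measurable A -> pr mu A <= p ->
  small Prob (expR (- (lam * m)) * (1 + expR lam * p) ^+ n) [set s | m <= cnt A s].
Proof.
move=> l0 mA Ap.
pose l x : bool := x \in A.
have lT : l @^-1` [set true] = A.
  by apply/seteqP; split => x; [exact: set_mem|exact: mem_set].
have lF : l @^-1` [set false] = ~` A.
  apply/seteqP; split => x; last by move=> xA; exact: memNset.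
  by rewrite /l /= => h /mem_set; rewrite h.
have ml b : measurable (l @^-1` [set b]).
  by case: b; rewrite ?lT ?lF //; exact: measurableC.
have [mE leE] := chernoff_label hiid (fun b : bool => lam * b%:R) (lam * m) ml.
apply: (@small_sub _ _ _ _ _ _ _ _ _ (lexx _) (small_measurable mE _)).
  move=> s /= h; rewrite -mulr_sumr ler_wpM2l //.
apply: le_trans leE _; rewrite ler_wpM2l ?expR_ge0 // lerXn2r ?nnegrE //.
- by apply: sumr_ge0 => b _; rewrite mulr_ge0 ?expR_ge0 ?pr_ge0.
- by rewrite addr_ge0 // mulr_ge0 ?expR_ge0 // (le_trans (pr_ge0 mu A)).
rewrite big_bool /= lT lF mulr1 mulr0 expR0 mul1r prC //.
have := ler_wpM2l (expR_ge0 lam) Ap; have := pr_ge0 mu A; lra.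
Qed.

End deviations.

(** * Numerical inequalities for the sums along the chain *)

Section numerics.
Context {R : realType}.
Implicit Types (x y m d : R) (k : nat).

Lemma expRN_natX k : expR (- k%:R) <= 2^-1 ^+ k :> R.
Proof.
rewrite -mulN1r expRM_natr lerXn2r ?nnegrE ?expR_ge0 //.
by rewrite expRN lef_pV2 ?posrE ?expR_gt0 //; apply: le_trans (expR_ge1Dx _).
Qed.

Lemma expR_natX_le k : 2 ^+ k <= expR k%:R :> R.
Proof.
rewrite -[k%:R]mul1r expRM_natr lerXn2r ?nnegrE ?expR_ge0 //.
exact: le_trans (expR_ge1Dx _).
Qed.

(** Entropy [99 d (k+1)] against deviation [110 m (k+1)]: the surplus [11 m (k+1)] pays for [m], for
    the geometric weight and for [exp(- 5) <= 1/32]. The factor 2 stands for the two signs of a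
    deviation. *)
Lemma level_budget m d k : 2 <= m -> d <= m ->
  expR (99 * d * k.+1%:R) * (2 * expR (- (110 * m * k.+1%:R)))
    <= expR (- m) / 16 * 2^-1 ^+ k.+1.
Proof.
move=> m2 dm; have k1 : 1 <= k.+1%:R :> R by rewrite ler1n.
rewrite mulrCA -expRD.
have : expR (99 * d * k.+1%:R - 110 * m * k.+1%:R) <=
    expR (- m) * (expR (- k.+1%:R) * expR (- 5%:R)).
  rewrite -!expRD ler_expR.
  have h1 : 0 <= (m - d) * k.+1%:R by rewrite mulr_ge0 // subr_ge0.
  have h2 : 0 <= (m - 2) * k.+1%:R by rewrite mulr_ge0 // subr_ge0.
  have h3 : 0 <= m * (k.+1%:R - 1) by rewrite mulr_ge0 ?subr_ge0 //; lra.
  rewrite mulrBl in h1; rewrite mulrBl in h2; rewrite mulrBr mulr1 in h3.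
  lra.
have := expRN_natX k.+1; have := expRN_natX 5.
have e5 : 2^-1 ^+ 5 = (32 : R)^-1 by rewrite exprVn -natrX.
rewrite e5 => h5 hk h.
have : expR (- k.+1%:R) * expR (- 5%:R) <= 2^-1 ^+ k.+1 * 32^-1 :> R.
  exact: (ler_pM (expR_ge0 _) (expR_ge0 _) hk h5).
move=> /(ler_wpM2l (expR_ge0 (- m))); lra.
Qed.

Lemma sum_geo_half k : \sum_(j < k) 2^-1 ^+ j <= 2 :> R.
Proof.
suff -> : \sum_(j < k) 2^-1 ^+ j = 2 - 2 * 2^-1 ^+ k :> R.
  by rewrite gerBl mulr_ge0 // exprn_ge0.
elim: k => [|k IH]; first by rewrite big_ord0 expr0; ring.
by rewrite big_ord_recr /= IH exprS; field.
Qed.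

Lemma sum_arith_geo_half k : \sum_(j < k) j.+1%:R * 2^-1 ^+ j <= 4 :> R.
Proof.
suff -> : \sum_(j < k) j.+1%:R * 2^-1 ^+ j = 4 - (2 * k%:R + 4) * 2^-1 ^+ k :> R.
  by rewrite gerBl mulr_ge0 ?exprn_ge0 // addr_ge0 // mulr_ge0.
elim: k => [|k IH]; first by rewrite big_ord0 expr0 mulr0; ring.
by rewrite big_ord_recr /= IH exprS -natr1; field.
Qed.

Lemma sum_pow2_le k : \sum_(j < k) 2 ^+ j <= 2 ^+ k :> R.
Proof.
elim: k => [|k IH]; first by rewrite big_ord0.
by rewrite big_ord_recr /= exprS; lra.
Qed.

Lemma succ_le_pow2 k : k.+1%:R <= 2 ^+ k :> R.
Proof. by rewrite -natrX ler_nat ltn_expl. Qed.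

Lemma quarter_half k : 4^-1 ^+ k = 2^-1 ^+ k * 2^-1 ^+ k :> R.
Proof. by rewrite -exprMn -invfM; congr (_^-1 ^+ _); ring. Qed.

Lemma sixteenth_quarter k : 16^-1 ^+ k = 4^-1 ^+ k * 4^-1 ^+ k :> R.
Proof. by rewrite -exprMn -invfM; congr (_^-1 ^+ _); ring. Qed.

Lemma gauss_tail_le x : 0 < x -> expR (- x ^+ 2) <= (2 * x)^-1.
Proof.
move=> x0; rewrite expRN lef_pV2 ?posrE ?expR_gt0 ?mulr_gt0 //.
apply: le_trans (expR_ge1Dx _); have := sqr_ge0 (x - 1); rewrite !expr2; lra.
Qed.

End numerics.

(** * Chaining *)

Lemma indic_diff {R : realType} (x y e f g : bool) : (~~ e -> ~~ f -> ~~ g -> x = y) ->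
  `|x%:R - y%:R| <= e%:R + (f%:R + g%:R) :> R.
Proof.
have xy1 : `|x%:R - y%:R| <= 1 :> R.
  by case: x; case: y; rewrite /= ?subrr ?subr0 ?sub0r ?normrN ?normr1 ?normr0.
case: e => [_|]; first by apply: le_trans xy1 _; rewrite lerDl addr_ge0.
case: f => [_|]; first by apply: le_trans xy1 _; rewrite add0r lerDl.
case: g => [_|]; first by rewrite !add0r.
by move=> /(_ isT isT isT) ->; rewrite subrr normr0 !addr0.
Qed.

Section chaining.
Context {R : realType} (p1 p2 r n : nat).
Context (S : 'M[R]_(p1 * p2)) (B : 'M[R]_(p1, p2)) (b eps tau rho : R).
Context (PB mu : probability (@Obs R p1 p2) R).
Context (Prob : probability (n.-tuple (@Obs R p1 p2)) R).
Context (net : nat -> seq 'M[R]_(p1, p2)) (K L : nat) (G : set (@Obs R p1 p2)).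

Let d : R := (r * (p1 + p2))%:R.
Let m : R := n%:R * tau ^+ 2.
Let tv (U : 'M[R]_(p1, p2)) := S *m vecc U.
Let unit_mx := unit_lowrank (2 * r) S.
Let D (U : 'M[R]_(p1, p2)) := dset B b U.
Let close k V V' := enorm (tv V - tv V') <= 2 * 16^-1 ^+ k.

Context (b0 : 0 <= b).
Context (bad_le : forall V a, 0 <= a -> enorm (tv V) = 1 -> pr PB (bad B b V a) <= 2 * a).
Context (far_le : forall W s t, enorm (tv W) <= s -> 0 < s -> 0 < t ->
  pr PB (far W t) <= 2 * expR (- (t / (2 * s)) ^+ 2)).
Context (hiid : iid Prob mu).
Context (eps0 : 0 <= eps).
Context (eps_tau : eps <= tau).
Context (tau01 : 0 < tau <= 1).
Context (mu_le : forall A, measurable A -> pr mu A <= pr PB A + eps).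
Context (d_m : d <= m).
Context (m2 : 2 <= m).
Context (mG : measurable G).
Context (Gc_le : pr mu (~` G) <= 3 * tau).
Context (G_le : forall A, measurable A -> pr mu (A `&` G) <= 2 * pr PB A).
Context (G_lin : forall w, G w -> forall U, `|lin U w.1| <= rho * enorm (tv U)).
Context (net_unit : forall k V, V \in net k -> unit_mx V).
Context (net_size : forall k, (size (net k) <= 2 * 256 ^ (2 * k.+1 * (2 * r * (p1 + p2))))%N).
Context (net_cover : forall k U, unit_mx U ->
  exists2 V, V \in net k & enorm (tv U - tv V) <= 16^-1 ^+ k).
(* The chain stops at the scale [2 ^- K ~ tau]; the levels between [K] and [K + L] only see
   the observations in [G], where finitely many levels suffice since [lin] is bounded there. *)
Context (K_le : 2 ^+ K * tau <= 1).
Context (K_gt : 1 < 2 ^+ K.+1 * tau).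
Context (rho0 : 0 <= rho).
Context (L_rho : rho * 16^-1 ^+ (K + L) < 4^-1 ^+ K / 2).

Let tau0 : 0 < tau. Proof. by case/andP: tau01. Qed.

Let tvB U V : tv (U - V) = tv U - tv V.
Proof. by rewrite /tv /vecc !linearB. Qed.

Let closeC k V V' : close k V V' -> close k V' V.
Proof. by rewrite /close -enormN opprB. Qed.

Let mD U : measurable (D U). Proof. exact: measurable_dset. Qed.

Context (d1 : 1 <= d).

(** Directions are [16^-k] close while the margin is [a = 4^-k], its square root, so the [far] tail
    [2 exp(- (1 / (4 a))^2)] is at most [4 a]. With [2 a] for [bad] this is [6 a], plus [eps] for
    the contamination, and both differences are counted. *)
Lemma dset_diff k U V : unit_mx U -> unit_mx V -> close k U V ->
  pr mu (D U `\` D V) + pr mu (D V `\` D U) <= 12 * 4^-1 ^+ k + 2 * eps.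
Proof.
have a0 : 0 < 4^-1 ^+ k :> R by rewrite exprn_gt0.
have half U' V' : unit_mx V' -> close k U' V' ->
    pr PB (bad B b V' (4^-1 ^+ k)) + pr PB (far (U' - V') (4^-1 ^+ k)) <= 6 * 4^-1 ^+ k.
  move=> [_ V1] UV.
  have h1 := bad_le (ltW a0) V1.
  have s0 : 0 < 2 * 16^-1 ^+ k :> R by rewrite mulr_gt0 // exprn_gt0.
  have h2 : pr PB (far (U' - V') (4^-1 ^+ k)) <= 2 * expR (- (4^-1 ^+ k / (2 * (2 * 16^-1 ^+ k))) ^+ 2).
    by apply: far_le => //; rewrite tvB.
  have e : 4^-1 ^+ k / (2 * (2 * 16^-1 ^+ k)) = (4 * 4^-1 ^+ k)^-1 :> R.
    by rewrite sixteenth_quarter; field; rewrite gt_eqF.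
  have h3 := @gauss_tail_le R (4 * 4^-1 ^+ k)^-1; rewrite e in h2.
  have i0 : 0 < (4 * 4^-1 ^+ k : R)^-1 by rewrite invr_gt0 mulr_gt0.
  have e2 : (2 * (4 * 4^-1 ^+ k)^-1)^-1 = 2 * 4^-1 ^+ k :> R.
    by rewrite invfM invrK; field.
  have := h3 i0; rewrite e2; lra.
have one U' V' : unit_mx V' -> close k U' V' ->
    pr mu (D U' `\` D V') <= 6 * 4^-1 ^+ k + eps /\ pr mu (D V' `\` D U') <= 6 * 4^-1 ^+ k + eps.
  move=> uV UV; have h := half _ _ uV UV.
  have mb := measurable_bad B b V' (4^-1 ^+ k); have mf := measurable_far (U' - V') (4^-1 ^+ k).
  have mbf := measurableU _ _ mb mf.
  have h' : pr mu (bad B b V' (4^-1 ^+ k) `|` far (U' - V') (4^-1 ^+ k)) <= 6 * 4^-1 ^+ k + eps.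
    apply: le_trans (mu_le mbf) _; rewrite lerD2r.
    exact: le_trans (prU _ mb mf) h.
  have cl w : ~ (bad B b V' (4^-1 ^+ k) `|` far (U' - V') (4^-1 ^+ k)) w -> D U' w <-> D V' w.
    by move=> /not_orP[nb nf]; exact: dset_close nb nf.
  split; apply: le_trans h'; apply: pr_le => //; try exact: measurableD.
    by move=> w [Uw Vw]; apply: contrapT => /cl h1; apply: Vw; apply/h1.
  by move=> w [Vw Uw]; apply: contrapT => /cl h1; apply: Uw; apply/h1.
move=> uU uV UV; have [h1 h2] := one _ _ uV UV; lra.
Qed.

Lemma net_size_exp k : (size (net k))%:R <= expR (33 * d * k.+1%:R).
Proof.
apply: (@le_trans _ _ (2 ^+ (33 * (r * (p1 + p2)) * k.+1))).
  rewrite -natrX ler_nat; apply: leq_trans (net_size k) _.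
  have -> : 256%N = (2 ^ 8)%N by [].
  rewrite -expnM -expnS leq_exp2l //.
  have : (0 < r * (p1 + p2))%N by have := d1; rewrite /d ler1n.
  rewrite -(mulnA 2 r); move: (r * (p1 + p2))%N => q q0.
  have -> : (8 * (2 * k.+1 * (2 * q)) = 32 * (q * k.+1))%N by ring.
  have : (0 < q * k.+1)%N by rewrite muln_gt0 q0.
  by move=> x0; rewrite -(mulnA 33) ltn_pmul2r.
by apply: le_trans (expR_natX_le _) _; rewrite ler_expR natrM (natrM _ 33).
Qed.

(** The exponent is that of [pair_union], where [33 (k+1) + 33 (k+2) <= 99 (k+1)], so that
    [level_budget] serves both. *)
Lemma single_union k (F : 'M[R]_(p1, p2) -> set (n.-tuple (@Obs R p1 p2))) (e : R) : 0 <= e ->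
  (forall V, V \in net k -> small Prob e (F V)) ->
  small Prob (expR (99 * d * k.+1%:R) * e) [set s | exists2 V, V \in net k & F V s].
Proof.
move=> e0 h; apply: small_sub (small_seq h) => //; rewrite ler_wpM2r //.
apply: le_trans (net_size_exp k) _; rewrite ler_expR ler_wpM2r //.
have := d1; lra.
Qed.

Lemma pair_union k (F : 'M[R]_(p1, p2) -> 'M[R]_(p1, p2) -> set (n.-tuple (@Obs R p1 p2))) (e : R) :
  0 <= e ->
  (forall V V', V \in net k -> V' \in net k.+1 -> close k V V' -> small Prob e (F V V')) ->
  small Prob (expR (99 * d * k.+1%:R) * e)
    [set s | exists V V', [/\ V \in net k, V' \in net k.+1, close k V V' & F V V' s]].
Proof.
move=> e0 h.
pose ps := [seq (V, V') | V <- net k, V' <- net k.+1].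
pose F' (vv : 'M[R]_(p1, p2) * 'M[R]_(p1, p2)) := [set s | close k vv.1 vv.2 /\ F vv.1 vv.2 s].
have hF vv : vv \in ps -> small Prob e (F' vv).
  move=> /allpairsP [[V V'] /= [Vn Vn' ->]].
  have [c|c] := boolP (close k V V').
    by apply: small_sub (h _ _ Vn Vn' c) => // s [].
  by apply: small_sub (small0 Prob) => // s [/= cc]; rewrite cc in c.
apply: small_sub (small_seq hF).
  by move=> s [V [V' [Vn Vn' c Fs]]]; exists (V, V') => //; apply: allpairs_f.
rewrite ler_wpM2r // size_allpairs natrM.
apply: (@le_trans _ _ (expR (33 * d * k.+1%:R) * expR (33 * d * k.+2%:R))).
  by apply: ler_pM => //; exact: net_size_exp.
rewrite -expRD ler_expR -(natr1 k.+1).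
have k1 : 1 <= k.+1%:R :> R by rewrite ler1n.
have : 0 <= d * (k.+1%:R - 1) by rewrite mulr_ge0 ?subr_ge0 // (le_trans _ d1).
lra.
Qed.

Let Z U := dev mu (D U) : n.-tuple (@Obs R p1 p2) -> R.

(* Centering at [mu] instead of [PB] makes the contamination telescope along the chain; it
   only enters the variance of the increments. *)
Let base_bound : R := 221 * (n%:R * tau).
Let level_bound k : R :=
  n%:R * tau * (12 * 2^-1 ^+ k + 2 * eps * 2 ^+ k + 220 * (k.+1%:R * 2^-1 ^+ k)).

Lemma small_base : small Prob (expR (- m) / 16)
  [set s | exists2 V, V \in net 0 & base_bound <= `|Z V s|].
Proof.
have h := @level_budget R m d 0 m2 d_m.
have e0 : 0 <= 2 * expR (- (110 * m * 1)) by rewrite mulr_ge0 ?expR_ge0.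
apply: (small_sub _ _ (single_union (k := 0) e0 (F := fun V => [set s | base_bound <= `|Z V s|]) _)).
- by [].
- apply: le_trans h _.
  by rewrite expr1 ler_piMr ?divr_ge0 ?expR_ge0 //; lra.
move=> V _; rewrite mulr1.
(* With [lam = tau / 2] and [m = n tau^2], the two terms of [bernstein] are [n tau] and
   [220 n tau]. *)
have lt : 0 < tau / 2 <= 2^-1 by case/andP: tau01 => ? ?; lra.
have v1 : pr mu (D V `\` set0) + pr mu (set0 `\` D V) <= 1.
  by rewrite setD0 set0D pr0 addr0; exact: pr_le1.
have v1' : pr mu (set0 `\` D V) + pr mu (D V `\` set0) <= 1 by rewrite addrC.
have s1 := bernstein hiid (110 * m) (mD V) measurable0 lt v1.
have s2 := bernstein hiid (110 * m) measurable0 (mD V) lt v1'.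
rewrite mulrDl mul1r; apply: small_sub (smallU s1 s2) => // s /=.
have -> : dev mu set0 s = 0.
  by rewrite /dev /cnt big1 ?pr0 ?mulr0 ?subr0 // => i _; rewrite indicE in_set0.
have -> : 2 * n%:R * (tau / 2) * 1 + 110 * m / (tau / 2) = base_bound.
  by rewrite /base_bound /m; field; rewrite gt_eqF.
by rewrite ler_normr subr0 sub0r => /orP[]; [left|right].
Qed.

Lemma small_level k : (k < K)%N ->
  small Prob (expR (- m) / 16 * 2^-1 ^+ k.+1)
  [set s | exists V V', [/\ V \in net k, V' \in net k.+1, close k V V' &
     level_bound k <= `|Z V' s - Z V s|]].
Proof.
move=> kK; have e0 : 0 <= 2 * expR (- (110 * m * k.+1%:R)) by rewrite mulr_ge0 ?expR_ge0.
apply: (small_sub _ _ (pair_union (k := k) e0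
  (F := fun V V' => [set s | level_bound k <= `|Z V' s - Z V s|]) _)).
- by [].
- exact: level_budget.
move=> V V' Vn Vn' c.
have uV := net_unit Vn; have uV' := net_unit Vn'.
(* This balances the variance [4^-k] against the entropy, leaving order [n tau (k+1) 2^-k] apart
   from the contamination. The constraint [lam <= 1/2] of [bernstein] is where [2^K tau <= 1]
   enters. *)
pose lam := tau * 2 ^+ k / 2.
have lt : 0 < lam <= 2^-1.
  rewrite /lam !mulr_gt0 ?exprn_gt0 //= -[leRHS]mul1r ler_pM2r //.
  apply: le_trans K_le; rewrite mulrC ler_pM2r // ler_eXn2l //; first exact: ltnW.
  lra.
have v1 := dset_diff uV uV' c.
have v2 := dset_diff uV' uV (closeC c).
have s1 := bernstein hiid (110 * m * k.+1%:R) (mD V) (mD V') lt v1.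
have s2 := bernstein hiid (110 * m * k.+1%:R) (mD V') (mD V) lt v2.
rewrite mulrDl mul1r; apply: small_sub (smallU s1 s2) => // s /=.
have -> : 2 * n%:R * lam * (12 * 4^-1 ^+ k + 2 * eps) + 110 * m * k.+1%:R / lam = level_bound k.
  rewrite /level_bound /m /lam quarter_half exprVn.
  by field; rewrite expf_neq0 //= gt_eqF.
by rewrite ler_normr => /orP[h|h]; [right|left; rewrite -(opprB (dev mu (D V') s))].
Qed.

Let bad_bound : R := 2 * n%:R * (2 * 4^-1 ^+ K + eps) + 2 * (110 * m * K.+1%:R).

(** When the last centred link [V] is replaced by [U], an observation changes side only near the
    boundary of [dset b V] or where [U - V] is [far]; this counts the former. *)
Lemma small_bad : small Prob (expR (- m) / 16)
  [set s | exists2 V, V \in net K & bad_bound <= cnt (bad B b V (4^-1 ^+ K)) s].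
Proof.
have h := @level_budget R m d K m2 d_m.
have e0 : 0 <= expR (- (110 * m * K.+1%:R)) by rewrite expR_ge0.
apply: (small_sub _ _ (single_union (k := K) e0
  (F := fun V => [set s | bad_bound <= cnt (bad B b V (4^-1 ^+ K)) s]) _)).
- by [].
- apply: le_trans (le_trans _ h) _.
    by rewrite ler_wpM2l ?expR_ge0 // ler_peMl ?expR_ge0 //; lra.
  rewrite ler_piMr ?divr_ge0 ?expR_ge0 //; apply: exprn_ile1; lra.
move=> V Vn; have [_ V1] := net_unit Vn.
have a0 : 0 <= 4^-1 ^+ K :> R by rewrite exprn_ge0.
have mb := measurable_bad B b V (4^-1 ^+ K).
have h' : pr mu (bad B b V (4^-1 ^+ K)) <= 2 * 4^-1 ^+ K + eps.
  by apply: le_trans (mu_le mb) _; rewrite lerD2r; apply: bad_le.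
exact: (count_deviation hiid (110 * m * K.+1%:R) mb h').
Qed.

Lemma small_contaminated : small Prob (expR (- m) / 16)
  [set s | 16 * (n%:R * tau) <= cnt (~` G) s].
Proof.
have mGc := measurableC mG.
have mm : m <= n%:R * tau.
  rewrite /m expr2 mulrA ler_piMr ?mulr_ge0 ?(ltW tau0) //; by case/andP: tau01.
(* The threshold is [6 n tau + 10 m], and [m <= n tau]. *)
apply: (small_sub _ _ (count_deviation hiid (5 * m) mGc Gc_le)).
  by move=> s /=; apply: le_trans; lra.
apply: (@le_trans _ _ (expR (- m) * expR (- 4%:R))).
  by rewrite -expRD ler_expR; have := m2; lra.
rewrite ler_wpM2l ?expR_ge0 //; apply: le_trans (expRN_natX 4) _.
by rewrite exprVn -natrX.
Qed.

(** These allowances sum to less than half of [4^-K]; the other half is left to the remainder past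
    level [K + L]. *)
Let gap j : R := 4^-1 ^+ K * 2^-1 ^+ j / 4.
Let far_count k : R := 16 * 114 * n%:R * k.+1%:R * 4^-1 ^+ k.

(** Relative to the distance of the links, the allowance grows with [j], so the mass on [G] is at
    most [4 exp(- lam^2)] with [lam = 1 / (16 * 4^-k)]. At this large [lam], a count of order only
    [n (k+1) 4^-k] already beats the entropy of level [k]. *)
Lemma small_far j : small Prob (expR (- m) / 16 * 2^-1 ^+ j.+1)
  [set s | exists V V', [/\ V \in net (K + j), V' \in net (K + j).+1, close (K + j) V V' &
     far_count (K + j) <= cnt (far (V' - V) (gap j) `&` G) s]].
Proof.
set k := (K + j)%N.
have e0 : 0 <= expR (- (110 * m * k.+1%:R)) by rewrite expR_ge0.
have h := @level_budget R m d k m2 d_m.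
have half1 : 0 <= (2^-1 : R) <= 1 by lra.
apply: (small_sub _ _ (pair_union (k := k) e0
  (F := fun V V' => [set s | far_count k <= cnt (far (V' - V) (gap j) `&` G) s]) _)).
- by [].
- apply: le_trans (le_trans _ h) _.
    by rewrite ler_wpM2l ?expR_ge0 // ler_peMl ?expR_ge0 //; lra.
  rewrite ler_wpM2l ?divr_ge0 ?expR_ge0 //.
  by rewrite ler_wiXn2l //; [lra|rewrite ltnS leq_addl].
move=> V V' Vn Vn' c.
pose q : R := 4^-1 ^+ k; have q0 : 0 < q by rewrite exprn_gt0.
pose lam := (16 * q)^-1; have l0 : 0 < lam by rewrite invr_gt0 mulr_gt0.
have g0 : 0 < gap j by rewrite /gap !mulr_gt0 ?exprn_gt0.
have mf := measurable_far (V' - V) (gap j).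
have fp : pr mu (far (V' - V) (gap j) `&` G) <= 4 * expR (- lam ^+ 2).
  apply: le_trans (G_le mf) _.
  have s0 : 0 < 2 * 16^-1 ^+ k :> R by rewrite mulr_gt0 // exprn_gt0.
  have f1 : pr PB (far (V' - V) (gap j)) <= 2 * expR (- (gap j / (2 * (2 * 16^-1 ^+ k))) ^+ 2).
    by apply: far_le => //; rewrite tvB; exact: closeC.
  have lt : lam <= gap j / (2 * (2 * 16^-1 ^+ k)).
    have p0 : 0 < 2^-1 ^+ j :> R by rewrite exprn_gt0.
    have p1' : 2^-1 ^+ j <= 1 :> R by apply: exprn_ile1; lra.
    have P0 : 0 < 4^-1 ^+ K :> R by rewrite exprn_gt0.
    have -> : gap j / (2 * (2 * 16^-1 ^+ k)) = lam / 2^-1 ^+ j.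
      rewrite /gap /lam /q sixteenth_quarter /k exprD (quarter_half j).
      by field; rewrite !gt_eqF.
    by rewrite ler_pdivlMr // ler_piMr // ltW.
  have : lam ^+ 2 <= (gap j / (2 * (2 * 16^-1 ^+ k))) ^+ 2.
    by rewrite lerXn2r ?nnegrE ?(ltW l0) // (le_trans (ltW l0)).
  rewrite -lerN2 => h2; apply: (le_trans (ler_wpM2l _ f1)) => //.
  have e4 : 2 * 2 = 4 :> R by ring.
  by rewrite [leLHS]mulrA e4 ler_pM2l // ler_expR.
have := count_tail hiid (far_count k) (ltW l0) (measurableI _ _ mf mG) fp.
apply: small_sub => //.
have -> : lam * far_count k = 114 * (n%:R * k.+1%:R).
  by rewrite /lam /far_count -/q; field; rewrite gt_eqF.
(* As [lam - lam^2 <= 1/4], one factor of the exponential moment is at most [9 <= exp 4]. The 114 in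
   [far_count] pays 110 for the union and 4 for this factor. *)
have e9 : 1 + expR lam * (4 * expR (- lam ^+ 2)) <= expR 4%:R.
  have -> : expR lam * (4 * expR (- lam ^+ 2)) = 4 * expR (lam - lam ^+ 2).
    by rewrite mulrCA -expRD.
  have e4 : expR (lam - lam ^+ 2) <= 2.
    apply: (@le_trans _ _ (expR 4^-1)).
      by rewrite ler_expR; have := sqr_ge0 (lam - 2^-1); rewrite !expr2; lra.
    by apply: (le_trans (expR_le_quad _)); rewrite ?expr2; lra.
  have := expR_natX_le (R := R) 4; rewrite -natrX; lra.
have e9n : (1 + expR lam * (4 * expR (- lam ^+ 2))) ^+ n <= expR (4 * n%:R).
  by rewrite expRM_natr lerXn2r ?nnegrE ?expR_ge0.
apply: le_trans (ler_wpM2l (expR_ge0 _) e9n) _.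
rewrite -expRD ler_expR.
have mn : m <= n%:R.
  by case/andP: tau01 => _ t1; rewrite /m ler_piMr // exprn_ile1 // ltW.
have k1 : 1 <= k.+1%:R :> R by rewrite ler1n.
have h1 : 0 <= (n%:R - m) * k.+1%:R by rewrite mulr_ge0 // subr_ge0.
have h2 : 0 <= n%:R * (k.+1%:R - 1) :> R by rewrite mulr_ge0 // subr_ge0.
lra.
Qed.

(** If no link exceeded its [gap], telescoping would keep [lin (U - V K)] below [4^-K], the
    remainder being controlled on [G] through [rho]. *)
Let far_cover (V : nat -> 'M[R]_(p1, p2)) U w :
  enorm (tv U - tv (V (K + L)%N)) <= 16^-1 ^+ (K + L) ->
  (far (U - V K) (4^-1 ^+ K) `&` G) w ->
  exists2 j, (j < L)%N & (far (V (K + j).+1 - V (K + j)%N) (gap j) `&` G) w.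
Proof.
move=> UV [fw Gw]; apply: contrapT => no.
have small j : (j < L)%N -> `|lin (V (K + j).+1 - V (K + j)%N) w.1| <= gap j.
  move=> jL; rewrite leNgt; apply/negP => h; apply: no; exists j => //; split => //.
  exact: ltW.
have tele l : (l <= L)%N ->
    `|lin (V (K + l)%N - V K) w.1| <= 4^-1 ^+ K / 2 * (1 - 2^-1 ^+ l).
  elim: l => [_|l IH lL].
    by rewrite addn0 linB expr0 !subrr normr0 mulr0.
  have -> : V (K + l.+1)%N - V K = (V (K + l).+1 - V (K + l)%N) + (V (K + l)%N - V K).
    by rewrite addnS subrKA.
  rewrite linD; apply: le_trans (ler_normD _ _) _.
  apply: le_trans (lerD (small l lL) (IH (ltnW lL))) _.
  by rewrite /gap exprS; lra.
have last : `|lin (U - V (K + L)%N) w.1| <= rho * 16^-1 ^+ (K + L).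
  by apply: le_trans (G_lin Gw _) _; rewrite tvB ler_wpM2l.
have e : U - V K = (U - V (K + L)%N) + (V (K + L)%N - V K) by rewrite addrA subrK.
move: fw; rewrite /far /= e linD => fw.
have := le_trans fw (ler_normD _ _).
have p0 : 0 <= 4^-1 ^+ K / 2 * 2^-1 ^+ L :> R by rewrite mulr_ge0 ?divr_ge0 ?exprn_ge0.
have := tele L (leqnn L); have := L_rho; lra.
Qed.

(** Five exceptional events of mass [exp(- m) / 16] each. Off them the argument is deterministic:
    every [U] is joined to its own chain of net points. *)
Lemma uniform_deviation : small Prob (expR (- m) * (5 / 16))
  [set s | ~ ((forall U, unit_mx U -> `|Z U s| <= 90 * 100 * (n%:R * tau)) /\
              cnt (~` G) s <= 16 * (n%:R * tau))].
Proof.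
have e16 : 0 <= expR (- m) / 16 by rewrite divr_ge0 ?expR_ge0.
have sl := small_levels e16 small_level.
have sf := small_levels e16 (fun j (_ : (j < L)%N) => small_far j).
have := smallU small_base (smallU sl (smallU small_bad (smallU small_contaminated sf))).
apply: small_sub; last by lra.
move=> s /= bads; apply: contrapT => /not_orP[nbase /not_orP[nlev /not_orP[nbad /not_orP[ncon nfar]]]].
have con : cnt (~` G) s <= 16 * (n%:R * tau).
  by rewrite leNgt; apply/negP => /ltW.
apply: bads; split => // U uU.
have exV k : exists V, V \in net k /\ enorm (tv U - tv V) <= 16^-1 ^+ k.
  by have [V ? ?] := net_cover k uU; exists V.
have [V Vp] := choice exV.
have Vn k : V k \in net k by have [] := Vp k.
have Vc k : enorm (tv U - tv (V k)) <= 16^-1 ^+ k by have [] := Vp k.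
have uV k : unit_mx (V k) by exact: net_unit (Vn k).
have cVV k : close k (V k) (V k.+1).
  rewrite /close; have -> : tv (V k) - tv (V k.+1) = (tv U - tv (V k.+1)) - (tv U - tv (V k)).
    by rewrite opprB [RHS]addrC subrKA.
  apply: le_trans (enormB _ _) _; apply: le_trans (lerD (Vc _) (Vc _)) _.
  have p0 : 0 < 16^-1 ^+ k :> R by rewrite exprn_gt0.
  by rewrite exprS; lra.
have nt0 : 0 <= n%:R * tau by rewrite mulr_ge0 // ltW.
have base : `|Z (V 0%N) s| <= 221 * (n%:R * tau).
  rewrite leNgt; apply/negP => h; apply: nbase; exists (V 0%N) => //; exact: ltW.
have lev k : (k < K)%N -> `|Z (V k.+1) s - Z (V k) s| <= level_bound k.
  move=> kK; rewrite leNgt; apply/negP => h; apply: nlev; exists k => //.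
  by exists (V k), (V k.+1); split => //; exact: ltW.
have cbad : cnt (bad B b (V K) (4^-1 ^+ K)) s <= bad_bound.
  rewrite leNgt; apply/negP => h; apply: nbad; exists (V K) => //; exact: ltW.
have cfar j : (j < L)%N ->
    cnt (far (V (K + j).+1 - V (K + j)%N) (gap j) `&` G) s <= far_count (K + j).
  move=> jL; rewrite leNgt; apply/negP => h; apply: nfar; exists j => //.
  by exists (V (K + j)%N), (V (K + j).+1); split => //; exact: ltW.
have chain : `|Z (V K) s| <= 221 * (n%:R * tau) + \sum_(k < K) level_bound k.
  have : forall l, (l <= K)%N -> `|Z (V l) s| <= 221 * (n%:R * tau) + \sum_(k < l) level_bound k.
    elim=> [_|l IH lK]; first by rewrite big_ord0 addr0.
    have -> : Z (V l.+1) s = Z (V l) s + (Z (V l.+1) s - Z (V l) s) by rewrite addrC subrK.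
    apply: le_trans (ler_normD _ _) _; rewrite big_ord_recr /= addrA.
    by apply: lerD; [exact: IH (ltnW lK)|exact: lev].
  exact.
have half_tau : 2^-1 ^+ K <= 2 * tau.
  rewrite exprVn invf_ple ?posrE ?exprn_gt0 ?mulr_gt0 //.
  rewrite -[leLHS]mul1r ler_pdivrMr ?mulr_gt0 //.
  by have := K_gt; rewrite exprS; lra.
have eK : eps * 2 ^+ K <= 1.
  by apply: le_trans K_le; rewrite mulrC ler_wpM2l // exprn_ge0.
have sum_lev : \sum_(k < K) level_bound k <= 906 * (n%:R * tau).
  rewrite /level_bound -mulr_sumr mulrC ler_wpM2r // !big_split /= -!mulr_sumr.
  have g1 := @sum_geo_half R K; have g2 := @sum_arith_geo_half R K.
  have g3 : 2 * eps * \sum_(k < K) 2 ^+ k <= 2.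
    have := ler_wpM2l eps0 (sum_pow2_le K); lra.
  lra.
have quarter_tau : 4^-1 ^+ K <= 2 * tau.
  apply: le_trans half_tau; rewrite quarter_half ler_piMr ?exprn_ge0 //.
  by apply: exprn_ile1; lra.
(* [K + 1 <= 2^K <= 1 / tau] turns [m (K+1)] into at most [n tau]. *)
have bb : bad_bound <= 230 * (n%:R * tau).
  have h1 : n%:R * (2 * 4^-1 ^+ K + eps) <= n%:R * (5 * tau).
    by rewrite ler_wpM2l //; have := eps_tau; lra.
  have h2 : m * K.+1%:R <= n%:R * tau.
    rewrite /m expr2 !mulrA -mulrA ler_piMr //.
    apply: le_trans K_le; rewrite mulrC ler_pM2r //; exact: succ_le_pow2.
  by rewrite /bad_bound; lra.
(* [(k+1) 2^-k <= 1] reduces [far_count] at [k = K + j] to order [n 2^-K 2^-j], and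
   [2^-K <= 2 tau]. *)
have far_sum : cnt (far (U - V K) (4^-1 ^+ K) `&` G) s <= 73 * 100 * (n%:R * tau).
  apply: (@le_trans _ _ (\sum_(j < L) cnt (far (V (K + j).+1 - V (K + j)%N) (gap j) `&` G) s)).
    rewrite /cnt exchange_big /=; apply: ler_sum => i _.
    have sum0 : 0 <= \sum_(j < L) \1_(far (V (K + j).+1 - V (K + j)%N) (gap j) `&` G) (tnth s i) :> R.
      by apply: sumr_ge0 => j _; rewrite indicE.
    rewrite [leLHS]indicE; have [/set_mem fi|//] := boolP (_ \in _).
    have [j jL /mem_set fj] := far_cover (Vc _) fi.
    rewrite (bigD1 (Ordinal jL)) //= indicE fj lerDl.
    by apply: sumr_ge0 => j' _; rewrite indicE.
  apply: (@le_trans _ _ (\sum_(j < L) 16 * 114 * (n%:R * 2^-1 ^+ K) * 2^-1 ^+ j)).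
    apply: ler_sum => j _; apply: le_trans (cfar j (ltn_ord j)) _.
    rewrite /far_count quarter_half.
    have e : (K + j).+1%:R * (2^-1 ^+ (K + j)) <= 1 :> R.
      by rewrite exprVn ler_pdivrMr ?exprn_gt0 // mul1r succ_le_pow2.
    have q0 : 0 <= n%:R * 2^-1 ^+ (K + j) :> R by rewrite mulr_ge0 // exprn_ge0.
    have := ler_wpM2l q0 e; rewrite exprD; lra.
  rewrite -mulr_sumr.
  have q0 : 0 <= n%:R * 2^-1 ^+ K :> R by rewrite mulr_ge0 // exprn_ge0.
  have := ler_wpM2l q0 (sum_geo_half L).
  have := ler_wpM2l (ler0n R n) half_tau; lra.
have cl : close K U (V K).
  apply: le_trans (Vc K) _; rewrite ler_peMl ?exprn_ge0 //; lra.
have dif := dset_diff uU (uV K) cl.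
have sub1 A A' : measurable A -> measurable A' -> pr mu A - pr mu A' <= pr mu (A `\` A').
  move=> mA mA'; rewrite (prDI mu mA mA').
  have := pr_le mu (measurableI _ _ mA mA') mA' (@subIsetr _ A A'); lra.
have pr_dif : `|pr mu (D U) - pr mu (D (V K))| <= 26 * tau.
  have := sub1 _ _ (mD U) (mD (V K)); have := sub1 _ _ (mD (V K)) (mD U).
  have := pr_ge0 mu (D U `\` D (V K)); have := pr_ge0 mu (D (V K) `\` D U).
  by have := eps_tau; rewrite ler_norml => *; apply/andP; split; lra.
have cnt_dif : `|cnt (D U) s - cnt (D (V K)) s| <= cnt (bad B b (V K) (4^-1 ^+ K)) s +
    (cnt (~` G) s + cnt (far (U - V K) (4^-1 ^+ K) `&` G) s) :> R.
  rewrite /cnt -sumrB -!big_split /=; apply: le_trans (ler_norm_sum _ _ _) _.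
  apply: ler_sum => i _; rewrite !indicE.
  apply: indic_diff => nb ng nf.
  have Gi : G (tnth s i) by apply: contrapT => h; move: ng; rewrite mem_set.
  have nb' : ~ bad B b (V K) (4^-1 ^+ K) (tnth s i) by move=> h; move: nb; rewrite mem_set.
  have nf' : ~ far (U - V K) (4^-1 ^+ K) (tnth s i).
    by move=> h; move: nf; rewrite mem_set.
  have [DUV DVU] := dset_close b0 nb' nf'.
  by apply/idP/idP => /set_mem h; apply/mem_set; [exact: DUV|exact: DVU].
(* In units of [n tau]: [221 + 906] for the chain, [230 + 16 + 7300] for the counts and 26 for the
   centring, below 9000. *)
have -> : Z U s = Z (V K) s + ((cnt (D U) s - cnt (D (V K)) s) - n%:R * (pr mu (D U) - pr mu (D (V K)))).
  by rewrite /Z /dev; ring.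
apply: le_trans (ler_normD _ _) _.
have := ler_normB (cnt (D U) s - cnt (D (V K)) s) (n%:R * (pr mu (D U) - pr mu (D (V K)))).
rewrite normrM (ger0_norm (ler0n R n)) => h.
have h' := ler_wpM2l (ler0n R n) pr_dif.
lra.
Qed.

End chaining.

(** * Norms, depth and the theorem *)

Section norms.
Context {R : realType}.

Lemma sqr_frob p1 p2 (A : 'M[R]_(p1, p2)) : frob A ^+ 2 = \sum_i \sum_j A i j ^+ 2.
Proof.
rewrite sqr_sqrtr //; apply: sumr_ge0 => i _; apply: sumr_ge0 => j _; exact: sqr_ge0.
Qed.

Lemma frob_gt0 p1 p2 (A : 'M[R]_(p1, p2)) : A != 0 -> 0 < frob A.
Proof.
move=> A0; rewrite lt0r sqrtr_ge0 andbT; apply: contra A0 => /eqP f0.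
have := sqr_frob A; rewrite f0 expr0n /= => /esym/eqP.
rewrite psumr_eq0 => [/allP h|i _]; last by apply: sumr_ge0 => j _; exact: sqr_ge0.
apply/eqP/matrixP => i j; rewrite mxE.
have := h i (mem_index_enum _); rewrite /= psumr_eq0 => [/allP h'|k _]; last exact: sqr_ge0.
by have := h' j (mem_index_enum _); rewrite /= sqrf_eq0 => /eqP.
Qed.

Lemma kappa_frob p1 p2 r (S : 'M[R]_(p1 * p2)) (A : 'M[R]_(p1, p2)) :
  lowrank (2 * r) A -> 0 <= kappa r S /\ kappa r S * frob A <= enorm (S *m vecc A).
Proof.
move=> lA; pose X := [set k | exists A' : 'M[R]_(p1, p2),
  lowrank (2 * r) A' /\ k = enorm (S *m vecc A') / frob A'].
have lb0 : lbound X 0.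
  by move=> k [A' [_ ->]]; rewrite divr_ge0 ?enorm_ge0 // sqrtr_ge0.
have XA : X (enorm (S *m vecc A) / frob A) by exists A.
split; first by rewrite /kappa; apply: lb_le_inf => //; exists (enorm (S *m vecc A) / frob A).
rewrite -ler_pdivlMr; last by apply: frob_gt0; case: lA.
by apply: ge_inf => //; exists 0.
Qed.

Lemma sqr_frob_tr p1 p2 (A : 'M[R]_(p1, p2)) : frob A ^+ 2 = \tr (A^T *m A).
Proof.
rewrite sqr_frob exchange_big /mxtrace; apply: eq_bigr => j _; rewrite mxE.
by apply: eq_bigr => i _; rewrite mxE expr2.
Qed.

(** Each nonzero entry lies in its own column and puts the corresponding basis vector into the row
    space of [D]. *)
Lemma card_diag_support p1 p2 (D : 'M[R]_(p1, p2)) :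
  (forall (i : 'I_p1) (j : 'I_p2), (i : nat) != j -> D i j = 0) ->
  (#|[pred ij : 'I_p1 * 'I_p2 | D ij.1 ij.2 != 0%R]| <= \rank D)%N.
Proof.
move=> diag.
pose J (j : 'I_p2) := [exists i, D i j != 0].
have le1 : (#|[pred ij : 'I_p1 * 'I_p2 | D ij.1 ij.2 != 0%R]| <= #|J|)%N.
  have inj : {in [pred ij : 'I_p1 * 'I_p2 | D ij.1 ij.2 != 0%R] &, injective (@snd 'I_p1 'I_p2)}.
    move=> [i j] [i' j'] hi hi' /= jj.
    have Dij : D i j != 0 := hi; have Di'j' : D i' j' != 0 := hi'.
    rewrite -jj in Di'j' *; congr (_, _).
    have h k : D k j != 0 -> (k : nat) = j by move=> Dk; apply/eqP; apply: contraNT Dk => /diag ->.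
    by apply/val_inj; rewrite /= (h i) // (h i').
  rewrite -(card_in_image inj).
  apply: subset_leq_card; apply/fintype.subsetP => j /fintype.imageP[[i k]].
  by move=> Dik ->; apply/existsP; exists i; exact: Dik.
apply: leq_trans le1 _.
have sub : (\sum_(j | J j) <<delta_mx 0 j : 'rV[R]_p2>> <= D)%MS.
  apply/sumsmx_subP => j /existsP[i Dij]; rewrite genmxE.
  have -> : delta_mx 0 j = (D i j)^-1 *: row i D :> 'rV[R]_p2.
    apply/rowP => k; rewrite !mxE eqxx /=.
    have [->|kj] := eqVneq k j; first by rewrite mulVf.
    have ij : (i : nat) = j by apply/eqP; apply: contraNT Dij => /diag ->.
    rewrite (diag i k) ?mulr0 //; apply: contra kj => /eqP ik; apply/eqP/val_inj.
    by rewrite /= -ik ij.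
  by apply: scalemx_sub; exact: row_sub.
apply: leq_trans (mxrankS sub).
have /mxdirectP /= -> : mxdirect (\sum_(j | J j) <<delta_mx 0 j : 'rV[R]_p2>>)%MS.
  by apply: (@mxdirect_delta _ _ _ p2 id) => j k.
rewrite (eq_bigr (fun => 1%N)) ?sum1_card // => j _.
by rewrite genmxE mxrank_delta.
Qed.

Lemma svd_sum_le p1 p2 (A : 'M[R]_(p1, p2)) U D V :
  is_svd A U D V -> svd_sum D ^+ 2 <= (\rank A)%:R * frob A ^+ 2.
Proof.
move=> [UU VV diag D0 AE].
have fA : frob A ^+ 2 = frob D ^+ 2.
  rewrite !sqr_frob_tr AE !trmx_mul trmxK !mulmxA mxtrace_mulC !mulmxA VV mul1mx.
  by rewrite -(mulmxA _ U^T U) UU mulmx1.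
have rA : (\rank D <= \rank A)%N.
  have -> : D = U^T *m A *m V by rewrite AE !mulmxA UU mul1mx -mulmxA VV mulmx1.
  by apply: leq_trans (mxrankM_maxl _ _) _; exact: mxrankM_maxr.
rewrite fA; apply: (@le_trans _ _ ((\rank D)%:R * frob D ^+ 2)); last first.
  by rewrite ler_wpM2r ?sqr_ge0 // ler_nat.
pose P := [pred ij : 'I_p1 * 'I_p2 | D ij.1 ij.2 != 0%R].
have sE : svd_sum D = \sum_(ij | P ij) D ij.1 ij.2.
  rewrite /svd_sum pair_bigA /= [RHS]big_mkcond; apply: eq_bigr => ij _.
  by rewrite /P /=; case: eqP => [->|].
have qE : frob D ^+ 2 = \sum_(ij | P ij) D ij.1 ij.2 ^+ 2.
  rewrite sqr_frob pair_bigA /= [RHS]big_mkcond; apply: eq_bigr => ij _.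
  by rewrite /P /=; case: eqP => [->|]; rewrite ?expr0n.
have cP := card_diag_support diag; rewrite -/P in cP.
apply: (@le_trans _ _ (#|P|%:R * frob D ^+ 2)); last first.
  by rewrite ler_wpM2r ?sqr_ge0 // ler_nat.
have [P0|P0] := posnP #|P|.
  rewrite P0 mul0r sE big1 ?expr0n // => ij Pij.
  have := card0_eq P0 ij; have -> : (ij \in P) = true by exact: Pij.
  by [].
set c : R := #|P|%:R; have c0 : 0 < c by rewrite ltr0n.
(* Cauchy-Schwarz over the support of [D], as nonnegativity of a sum of squares. *)
have : 0 <= \sum_(ij | P ij) (c * D ij.1 ij.2 - svd_sum D) ^+ 2.
  by apply: sumr_ge0 => ij _; rewrite sqr_ge0.
under eq_bigr do rewrite sqrrB exprMn.
rewrite !big_split /= sumrN -mulr_sumr -qE /= sumr_const.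
have -> : \sum_(ij | P ij) c * D ij.1 ij.2 * svd_sum D *+ 2 = 2 * c * svd_sum D ^+ 2.
  rewrite sumrMnl -mulr_suml -mulr_sumr -sE -(mulr_natl _ 2); ring.
rewrite -(mulr_natl (svd_sum D ^+ 2)) -/c => h.
have : 0 <= c * (c * frob D ^+ 2 - svd_sum D ^+ 2).
  by apply: le_trans h _; rewrite le_eqVlt; apply/orP; left; apply/eqP; ring.
by rewrite pmulr_rge0 // subr_ge0.
Qed.

End norms.

(** * Empirical depth as a normalised count *)

Section depth.
Context {R : realType} (p1 p2 n r : nat).
Implicit Types (B U : 'M[R]_(p1, p2)) (s : n.-tuple (@Obs R p1 p2)).

Definition depth_at s B U : R :=
  (#|[set i : 'I_n | 0 <= minner U (mat_of (tnth s i).1) *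
        ((tnth s i).2 - minner B (mat_of (tnth s i).1))]|)%:R / n%:R.

Lemma depth_at_cnt s B U : depth_at s B U =
  cnt [set w : @Obs R p1 p2 | 0 <= lin U w.1 * (w.2 - lin B w.1)] s / n%:R.
Proof.
by rewrite /depth_at /cnt -sum1_card big_mkcond natr_sum; congr (_ / _).
Qed.

Lemma emp_depth_le s B U : lowrank (2 * r) U -> emp_depth r s B <= depth_at s B U.
Proof.
move=> lU; apply: ge_inf; last by exists U.
by exists 0 => d [V [_ ->]]; rewrite divr_ge0.
Qed.

(** A direction is asked for because the infimum of the empty set is a default value. *)
Lemma emp_depth_ge s B (x : R) : (exists U, lowrank (2 * r) U) ->
  (forall U, lowrank (2 * r) U -> x <= depth_at s B U) -> x <= emp_depth r s B.
Proof.
move=> [U lU] h; apply: lb_le_inf; first by exists (depth_at s B U), U.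
by move=> d [V [lV ->]]; apply: h.
Qed.

End depth.

Lemma dyadic_scale {R : realType} (x : R) : 0 < x <= 1 ->
  exists K, 2 ^+ K * x <= 1 /\ 1 < 2 ^+ K.+1 * x.
Proof.
move=> /andP[x0 x1].
have ex : exists k, 1 < 2 ^+ k.+1 * x.
  have := archi_boundP (_ : 0 <= x^-1); rewrite invr_ge0 ltW // => /(_ isT) h.
  exists (Num.bound x^-1); rewrite -ltr_pdivrMr // div1r; apply: lt_trans h _.
  by apply: lt_le_trans (succ_le_pow2 _); rewrite ltr_nat.
exists (ex_minn ex); case: ex_minnP => k kx kmin; split => //.
case: k kx kmin => [|k] kx kmin; first by rewrite expr0 mul1r.
by rewrite leNgt; apply/negP => /kmin; rewrite ltnn.
Qed.

(** [L] depends on [rho], hence on [S]; this is harmless, as all bounds for the levels past [K] are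
    geometric in [j]. *)
Lemma fine_scale {R : realType} (rho : R) K : 0 <= rho ->
  exists L, rho * 16^-1 ^+ (K + L) < 4^-1 ^+ K / 2.
Proof.
move=> rho0; pose L := Num.bound (2 * rho).
have h : 2 * rho < L%:R by apply: archi_boundP; rewrite mulr_ge0.
have h2 : 2 * rho < 2 ^+ L :> R.
  by apply: lt_le_trans h _; apply: le_trans (succ_le_pow2 _); rewrite ler_nat.
exists L.
have q0 : 0 < 4^-1 ^+ K :> R by rewrite exprn_gt0.
have q1 : 4^-1 ^+ K <= 1 :> R by apply: exprn_ile1; lra.
have l0 : 0 < 2^-1 ^+ L :> R by rewrite exprn_gt0.
have l1 : 2^-1 ^+ L <= 1 :> R by apply: exprn_ile1; lra.
have e : 16^-1 ^+ L <= 2^-1 ^+ L :> R.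
  by rewrite lerXn2r ?nnegrE //; lra.
have e2 : 2 * rho * 16^-1 ^+ L < 1.
  apply: (@le_lt_trans _ _ (2 * rho * 2^-1 ^+ L)); first by rewrite ler_wpM2l ?mulr_ge0.
  by rewrite exprVn ltr_pdivrMr ?exprn_gt0 // mul1r.
rewrite exprD sixteenth_quarter.
have := ltr_pM2l q0 (4^-1 ^+ K * (2 * rho * 16^-1 ^+ L)) 1.
have r0 : 0 <= 2 * rho * 16^-1 ^+ L by rewrite !mulr_ge0 // exprn_ge0.
have : 4^-1 ^+ K * (2 * rho * 16^-1 ^+ L) < 1.
  by apply: le_lt_trans e2; rewrite ler_piMl.
by move=> -> /=; lra.
Qed.

(** One factor 2 comes from [tau^2 <= 2 t], another from the rank [2 r] in the nuclear norm, whence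
    4. Multiplying by [kappa] instead of dividing keeps the bounds meaningful when it vanishes. *)
Lemma risk_bounds {R : realType} (p1 p2 r n : nat) (S : 'M[R]_(p1 * p2))
    (A : 'M[R]_(p1, p2)) (sigma eps tau c : R) :
  0 <= c -> 0 <= sigma -> 0 <= tau -> tau ^+ 2 = eps ^+ 2 + (r * (p1 + p2))%:R / n%:R ->
  (\rank A <= 2 * r)%N -> enorm (S *m vecc A) <= c * sigma * tau ->
  let t := Num.max ((r * (p1 + p2))%:R / n%:R) (eps ^+ 2) in
  [/\ enorm (S *m vecc A) ^+ 2 <= 4 * c ^+ 2 * sigma ^+ 2 * t,
      kappa r S ^+ 2 * frob A ^+ 2 <= 4 * c ^+ 2 * sigma ^+ 2 * t
    & forall U D V, is_svd A U D V ->
        kappa r S ^+ 2 * svd_sum D ^+ 2 <= 4 * c ^+ 2 * sigma ^+ 2 *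
          Num.max ((r ^ 2 * (p1 + p2))%:R / n%:R) (r%:R * eps ^+ 2)].
Proof.
move=> c0 sigma0 tau0 tau2 rA key t.
have t_ge : tau ^+ 2 <= 2 * t.
  have := le_max ((r * (p1 + p2))%:R / n%:R) ((r * (p1 + p2))%:R / n%:R) (eps ^+ 2).
  have := le_max (eps ^+ 2) ((r * (p1 + p2))%:R / n%:R) (eps ^+ 2).
  by rewrite -/t !lexx orbT tau2 /=; lra.
have t0 : 0 <= t by rewrite /t le_max sqr_ge0 orbT.
have q0 : 0 <= c ^+ 2 * sigma ^+ 2 * t := mulr_ge0 (mulr_ge0 (sqr_ge0 _) (sqr_ge0 _)) t0.
have sq_key : enorm (S *m vecc A) ^+ 2 <= 2 * c ^+ 2 * sigma ^+ 2 * t.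
  apply: (@le_trans _ _ ((c * sigma * tau) ^+ 2)).
    by rewrite lerXn2r ?nnegrE ?enorm_ge0 // !mulr_ge0.
  rewrite !exprMn; have := ler_wpM2l (mulr_ge0 (sqr_ge0 c) (sqr_ge0 sigma)) t_ge; lra.
have frob_key : kappa r S ^+ 2 * frob A ^+ 2 <= 2 * c ^+ 2 * sigma ^+ 2 * t.
  apply: le_trans sq_key; rewrite -exprMn.
  (* [kappa] is an infimum over nonzero matrices only. *)
  have [A0|A0] := eqVneq A 0.
    have -> : frob A = 0.
      by rewrite A0 /frob big1 ?sqrtr0 // => i _; rewrite big1 // => j _; rewrite mxE expr0n.
    by rewrite mulr0 expr0n sqr_ge0.
  have [k0 kf] := kappa_frob S (conj A0 rA).
  by rewrite lerXn2r ?nnegrE ?enorm_ge0 ?mulr_ge0 ?sqrtr_ge0.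
split; [by apply: le_trans sq_key _; lra|by apply: le_trans frob_key _; lra|].
move=> U D V svd.
have -> : Num.max ((r ^ 2 * (p1 + p2))%:R / n%:R) (r%:R * eps ^+ 2) = r%:R * t.
  rewrite /t maxr_pMr //; congr Num.max.
  by rewrite mulrA -natrM expnS expn1 mulnA.
apply: (@le_trans _ _ (kappa r S ^+ 2 * (2 * r%:R * frob A ^+ 2))).
  rewrite ler_wpM2l ?sqr_ge0 //; apply: le_trans (svd_sum_le svd) _.
  by rewrite ler_wpM2r ?sqr_ge0 // -natrM ler_nat.
have := ler_wpM2l (ler0n R r) frob_key; lra.
Qed.

Theorem theorem6 (R : realType) :
  exists c0 C C' : R, 0 < c0 /\ 0 < C /\ 0 < C' /\
  forall (p1 p2 r n : nat) (sigma : R)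
    (Sigma S : 'M[R]_(p1 * p2)) (B : 'M[R]_(p1, p2)) (eps : R)
    (gamma : probability ((p1 * p2).-tuple R) R)
    (PB Q : probability (Obs p1 p2) R)
    (Prob : probability (n.-tuple (Obs p1 p2)) R),
    (1 <= p1)%N -> (1 <= p2)%N -> (1 <= r)%N -> (1 <= n)%N ->
    0 < sigma ->
    psd Sigma -> psd S -> S *m S = Sigma ->
    lowrank r B ->
    0 <= eps -> eps < 1 ->
    is_gaussian gamma Sigma ->
    is_model PB gamma B sigma ->
    iid_mixture Prob PB Q eps ->
    eps ^+ 2 + (r * (p1 + p2))%:R / n%:R <= c0 ->
    exists E : set (n.-tuple (Obs p1 p2)),
      measurable E /\
      (Prob E >= (1 - expR (- (C' * ((r * (p1 + p2))%:R + n%:R * eps ^+ 2))))%:E)%E /\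
      forall s, E s -> forall Bh : 'M[R]_(p1, p2), is_depth_max r s Bh ->
        let t := Num.max ((r * (p1 + p2))%:R / n%:R) (eps ^+ 2) in
        [/\ enorm (S *m vecc (Bh - B)) ^+ 2 <= C * sigma ^+ 2 * t,
            kappa r S ^+ 2 * frob (Bh - B) ^+ 2 <= C * sigma ^+ 2 * t
          & forall U D V, is_svd (Bh - B) U D V ->
              kappa r S ^+ 2 * svd_sum D ^+ 2 <=
              C * sigma ^+ 2 *
                Num.max ((r ^ 2 * (p1 + p2))%:R / n%:R) (r%:R * eps ^+ 2)].
Proof.
(* The 64 cancels the constant of [pr_dset_le], so that depth drops by [20000 tau] at distance [b];
   this exceeds the losses [9001 tau] for [B] and [9001 tau] for the estimator. [Kc] is kept opaque
   to the arithmetic. *)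
have [Kc KcE] : exists Kc : R, Kc = 64 * 200 * 100 by eexists.
have Kc1 : 1 <= Kc by rewrite KcE; lra.
have Kc0 : 0 < Kc by lra.
(* The first constant says [Kc tau <= 1], that is [b <= sigma]; the second is the one of
   [risk_bounds]. *)
exists (Kc ^- 2), (4 * Kc ^+ 2), 1.
split; first by rewrite invr_gt0 exprn_gt0.
split; first by rewrite mulr_gt0 // exprn_gt0.
split=> // p1 p2 r n sigma Sigma S B eps gamma PB Q Prob.
move=> p1_gt0 p2_gt0 r_gt0 n_gt0 sigma0 _ psdS SS lowB eps0 eps1 gaussian model mixture small_rate.
set d : R := (r * (p1 + p2))%:R in small_rate *.
have nR0 : 0 < n%:R :> R by rewrite ltr0n.
have d2 : 2 <= d.
  rewrite /d ler_nat; apply: (@leq_trans (1 * (1 + 1))%N) => //.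
  by apply: leq_mul => //; exact: leq_add.
pose tau := Num.sqrt (eps ^+ 2 + d / n%:R).
have dn0 : 0 < d / n%:R by rewrite divr_gt0 //; lra.
have rate0 : 0 < eps ^+ 2 + d / n%:R by rewrite ltr_wpDl ?sqr_ge0.
have tau2 : tau ^+ 2 = eps ^+ 2 + d / n%:R by rewrite sqr_sqrtr // ltW.
have tau0 : 0 < tau by rewrite sqrtr_gt0.
have Kctau : Kc * tau <= 1.
  have : (Kc * tau) ^+ 2 <= 1.
    by rewrite exprMn tau2 mulrC -ler_pdivlMr ?exprn_gt0 // mul1r.
  by rewrite expr_le1 // mulr_ge0 // ltW.
have tau1 : tau <= 1 by apply: le_trans Kctau; rewrite ler_peMl // ltW.
have tau01 : 0 < tau <= 1 by rewrite tau0 tau1.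
have eps_tau : eps <= tau.
  rewrite -(@ler_pXn2r _ 2) ?nnegrE ?(ltW tau0) // tau2 lerDl; exact: ltW.
have mE : n%:R * tau ^+ 2 = d + n%:R * eps ^+ 2.
  by rewrite tau2; field; rewrite gt_eqF.
have d_m : d <= n%:R * tau ^+ 2 by rewrite mE lerDl mulr_ge0 ?sqr_ge0.
have m2 : 2 <= n%:R * tau ^+ 2 by lra.
rewrite mul1r -mE.
have eps01 : 0 <= eps <= 1 by rewrite eps0 ltW.
have [mu muE] := mixture_exists PB Q eps01.
have hiid := iid_of_mixture muE mixture.
have muprE A : measurable A -> pr mu A = (1 - eps) * pr PB A + eps * pr Q A.
  by move=> mA; exact: mixture_pr (muE A).
have mu_le A : measurable A -> pr mu A <= pr PB A + eps.
  move=> mA; rewrite muprE //; have := ler_wpM2l eps0 (pr_le1 Q mA).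
  have := mulr_ge0 eps0 (pr_ge0 PB A); lra.
have [G0 [mG0 G0c G0le]] := clean_region eps01 muprE.
(* Domination by [2 PB] doubles this mass, so the complement of [G] has mass at most
   [2 eps + tau / 2 <= 3 tau]. *)
have tau4 : 0 < tau / 4 by rewrite divr_gt0.
have [D0 [rho [mD0 rho0 D0c D0lin]]] := bounded_region psdS SS gaussian tau4.
pose DD := [set w : @Obs R p1 p2 | D0 w.1].
have mDD : measurable DD by apply: measurable_preimage => //; exact: measurable_fst.
have mDDc := measurableC mDD.
have DDc : pr PB (~` DD) <= tau / 4.
  have mDc := measurableC mD0.
  have h := @pr_section_le R p1 p2 sigma B gamma PB sigma0 model (~` D0) setT 1 mDc measurableT ler01.
  rewrite setTI mul1r in h; apply: le_trans (h _) D0c.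
  move=> x _; apply: (@pr_le1 _ _ _ (normal_prob 0 sigma)).
  exact: (@measurable_section R p1 p2 B setT x measurableT).
pose G := G0 `&` DD.
have mG : measurable G by exact: measurableI.
have Gc : pr mu (~` G) <= 3 * tau.
  have sub : ~` G `<=` ~` G0 `|` (~` DD `&` G0).
    move=> w nG; have [g|g] := EM (G0 w); last by left.
    by right; split => // dw; apply: nG.
  have m1 := measurableC mG0; have m2' := measurableI _ _ mDDc mG0.
  apply: le_trans (pr_le mu (measurableC mG) (measurableU _ _ m1 m2') sub) _.
  apply: le_trans (prU mu m1 m2') _.
  have := G0le _ mDDc; lra.
have Gle A : measurable A -> pr mu (A `&` G) <= 2 * pr PB A.
  move=> mA; apply: le_trans (G0le _ mA); apply: pr_le.
  - exact: measurableI.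
  - exact: measurableI.
  - by move=> w [Aw [g _]].
have Glin w : G w -> forall U, `|lin U w.1| <= rho * enorm (S *m vecc U).
  by move=> [_ dw] U; exact: D0lin.
have [K [Kle Kgt]] := dyadic_scale tau01.
have [L Lrho] := fine_scale K (ltW rho0).
have D2 : (0 < 2 * r * (p1 + p2))%N.
  by rewrite !muln_gt0 r_gt0 addn_gt0 p1_gt0.
have [net netP] := choice (fun j => @lowrank_net R p1 p2 (2 * r) S j D2).
have net_unit k V : V \in net k -> unit_lowrank (2 * r) S V by have [h _ _] := netP k; exact: h.
have net_size k : (size (net k) <= 2 * 256 ^ (2 * k.+1 * (2 * r * (p1 + p2))))%N by have [] := netP k.
have net_cover k U : unit_lowrank (2 * r) S U ->
    exists2 V, V \in net k & enorm (S *m vecc U - S *m vecc V) <= 16^-1 ^+ k.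
  by rewrite exprVn; have [_ _ h] := netP k; exact: h.
pose b := Kc * sigma * tau.
have b0 : 0 <= b by rewrite /b !mulr_ge0 // ltW.
have bs : b <= sigma by rewrite /b mulrAC ler_piMl // ltW.
pose good (b' : R) (s : n.-tuple (@Obs R p1 p2)) := (forall U, unit_lowrank (2 * r) S U ->
    `|dev mu (dset B b' U) s| <= 90 * 100 * (n%:R * tau)) /\
    cnt (~` G) s <= 16 * (n%:R * tau).
have d1 : 1 <= d by lra.
have deviation b' : 0 <= (b' : R) <= sigma ->
    small Prob (expR (- (n%:R * tau ^+ 2)) * (5 / 16)) [set s | ~ good b' s].
  move=> /andP[b'0 b's].
  apply: (uniform_deviation (r := r) (S := S) (eps := eps) (rho := rho) (PB := PB)
     (net := net) (K := K) (L := L)) => //; last exact: ltW.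
  - by move=> V a a0 V1; apply: (pr_bad_le sigma0 psdS SS gaussian model) => //; rewrite b'0 b's.
  - by move=> W s t; exact: (pr_far_le sigma0 psdS SS gaussian model).
have z0 : 0 <= (0 : R) <= sigma by rewrite lexx ltW.
have bb : 0 <= b <= sigma by rewrite b0 bs.
(* Two failures of mass [5/16 exp(- m)] each stay below [exp(- m)]. *)
have [F [mF subF Fle]] := smallU (deviation 0 z0) (deviation b bb).
exists (~` F); split; first exact: measurableC.
split.
  rewrite prE; last exact: measurableC.
  rewrite lee_fin prC // lerB //; apply: le_trans Fle _.
  have := expR_ge0 (- (n%:R * tau ^+ 2) : R); lra.
move=> s nF Bh [lowBh maxBh].
have [dev0 conG] : good 0 s by apply: contrapT => h; apply: nF; apply: subF; left.
have [devb _] : good b s by apply: contrapT => h; apply: nF; apply: subF; right.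
have unitZ U : (\rank U <= 2 * r)%N -> enorm (S *m vecc U) != 0 ->
    unit_lowrank (2 * r) S ((enorm (S *m vecc U))^-1 *: U).
  move=> rU e0; split; first exact: leq_trans (mxrank_scale _ _) rU.
  have -> : vecc ((enorm (S *m vecc U))^-1 *: U) = (enorm (S *m vecc U))^-1 *: vecc U.
    by rewrite /vecc !linearZ.
  by rewrite -scalemxAr enormZ ger0_norm ?invr_ge0 ?enorm_ge0 // mulVf.
have depthB : 2^-1 - (90 * 100 + 1) * tau <= emp_depth r s B.
  apply: emp_depth_ge.
    exists B; split; first by case: lowB.
    by case: lowB => _ rB; apply: leq_trans rB _; rewrite leq_pmull.
  move=> U [_ rU]; rewrite depth_at_cnt ler_pdivlMr //.
  have setE : [set w : @Obs R p1 p2 | 0 <= lin U w.1 * (w.2 - lin B w.1)] = dset B 0 U.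
    by apply/seteqP; split => w; rewrite /dset /residual /= mul0r subr0.
  (* Along a direction killed by [S], [lin U] vanishes on [G], so every observation of [G] is
     counted and only the others, at most [16 n tau], can be lost. *)
  have [e0|e0] := eqVneq (enorm (S *m vecc U)) 0.
    have cG : n%:R <= cnt G s + cnt (~` G) s :> R.
      rewrite -[n in X in X <= _]card_ord -sum1_card natr_sum /cnt -big_split /=.
      apply: ler_sum => i _; rewrite !indicE in_setC -natrD ler_nat.
      by case: (_ \in G).
    have sub : G `<=` [set w : @Obs R p1 p2 | 0 <= lin U w.1 * (w.2 - lin B w.1)].
      move=> w Gw /=; have := Glin w Gw U; rewrite e0 mulr0 normr_le0 => /eqP ->.
      by rewrite mul0r.
    have := cnt_le (R := R) s sub; have := mulr_ge0 (ler0n R n) (ltW tau0); lra.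
  have uU := unitZ U rU e0; set U' := _ *: U in uU.
  have ep : 0 < enorm (S *m vecc U) by rewrite lt0r e0 enorm_ge0.
  have -> : [set w : @Obs R p1 p2 | 0 <= lin U w.1 * (w.2 - lin B w.1)] = dset B 0 U'.
    rewrite setE; apply/seteqP; split => w; rewrite /dset /residual /= !mul0r !subr0 /U' linZ -mulrA.
      by move=> h; rewrite mulr_ge0 // invr_ge0 ltW.
    by rewrite pmulr_rge0 // invr_gt0.
  have := dev0 U' uU; rewrite ler_norml /dev => /andP[h _].
  have mD' := measurable_dset B 0 U'.
  have PB_ge := pr_dset_ge sigma0 model U'.
  have mu_ge : 2^-1 - tau <= pr mu (dset B 0 U').
    rewrite muprE //; have := mulr_ge0 eps0 (pr_ge0 Q (dset B 0 U')).
    have : 0 <= (1 - eps) * (pr PB (dset B 0 U') - 2^-1) by rewrite mulr_ge0 ?subr_ge0 // ltW.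
    lra.
  have := ler_wpM2l (ler0n R n) mu_ge; lra.
(* In the direction [Bh - B], scaled down to norm [b], the population depth of [Bh] falls below
   [1/2] by a multiple of [tau] larger than all deviations. *)
have key : enorm (S *m vecc (Bh - B)) <= b.
  rewrite leNgt; apply/negP => eb.
  set Dl := Bh - B in eb; set e := enorm (S *m vecc Dl) in eb.
  have ep : 0 < e by apply: le_lt_trans eb.
  have rD : (\rank Dl <= 2 * r)%N.
    case: lowB lowBh => _ rB [_ rBh]; apply: leq_trans (mxrank_add _ _) _.
    by rewrite mxrank_opp mul2n -addnn leq_add.
  have Dn0 : Dl != 0.
    apply/eqP => D0'; move: ep; rewrite /e D0' /vecc !linear0 /enorm big1 ?sqrtr0 ?ltxx // => k _.
    by rewrite mxE expr0n.
  have uU := unitZ Dl rD (lt0r_neq0 ep); rewrite -/e in uU; set U' := e^-1 *: Dl in uU.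
  have lD : lowrank (2 * r) Dl by [].
  have := le_trans depthB (le_trans (maxBh B lowB) (emp_depth_le s Bh lD)).
  rewrite depth_at_cnt ler_pdivlMr //.
  (* Here [e > b] is used: [x z >= x^2] implies [e x z >= b x^2]. *)
  have sub : [set w : @Obs R p1 p2 | 0 <= lin Dl w.1 * (w.2 - lin Bh w.1)] `<=` dset B b U'.
    move=> w /=; have -> : lin Bh w.1 = lin B w.1 + lin Dl w.1.
      by rewrite -linD /Dl addrC subrK.
    rewrite /dset /residual /= /U' linZ; set x := lin Dl w.1; set z := w.2 - lin B w.1 => h.
    have h' : 0 <= x * (z - x) by move: h; rewrite opprD addrA.
    have -> : e^-1 * x * (z - b * (e^-1 * x)) = (e^-1) ^+ 2 * (e * (x * z) - b * x ^+ 2).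
      by field; rewrite gt_eqF.
    rewrite mulr_ge0 ?sqr_ge0 //.
    have : 0 <= e * (x * (z - x)) by rewrite mulr_ge0 // ltW.
    have : 0 <= (e - b) * x ^+ 2 by rewrite mulr_ge0 ?sqr_ge0 // subr_ge0 ltW.
    rewrite !expr2; lra.
  have c1 := cnt_le (R := R) s sub.
  have := devb U' uU; rewrite ler_norml /dev => /andP[_ h].
  have PB_le := pr_dset_le sigma0 psdS SS gaussian model bb (proj2 uU).
  have mu_le' : pr mu (dset B b U') <= 2^-1 - 200 * 100 * tau + tau.
    apply: le_trans (mu_le _ (measurable_dset B b U')) _; apply: lerD => //.
    apply: le_trans PB_le _; rewrite lerD2l lerN2 /b KcE.
    rewrite le_eqVlt; apply/orP; left; apply/eqP; field; by rewrite gt_eqF.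
  have := ler_wpM2l (ler0n R n) mu_le'.
  have := mulr_gt0 nR0 tau0; lra.
have rD : (\rank (Bh - B)%R <= 2 * r)%N.
  case: lowB lowBh => _ rB [_ rBh]; apply: leq_trans (mxrank_add _ _) _.
  by rewrite mxrank_opp mul2n -addnn leq_add.
exact: (risk_bounds (c := Kc) (ltW Kc0) (ltW sigma0) (ltW tau0) tau2 rD key).
Qed.
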